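(* Consider the constrained control problem of finding the sequence of conditional pdfs $\{(\tilde f_{\mathbf U}^k)^*\}_{k\in\mathcal K}$, $\mathcal K=\{1,\dots,n\}$, solving $$\min_{\{\tilde f_{\mathbf U}^k\}_{k\in\mathcal K}} \mathcal D_{\mathrm{KL}}(f^n\|g^n)\quad\text{s.t.}\quad \mathbb E_{\tilde f_{\mathbf U}^k}\big[\tilde{\mathbf h}_{\mathbf u,k}(\mathbf U)\big]=\tilde{\mathbf H}_{\mathbf u,k},\quad k\in\mathcal K,$$ where the constraints are algebraically independent (all objects as defined in the context). Then the solution $(\tilde f_{\mathbf U}^k)^*=f^*(\mathbf u_k|\mathbf x_{k-1})$ is $$\big(\tilde f_{\mathbf U}^k\big)^*=\tilde g_{\mathbf U}^k\,\frac{\exp\big(-\{\hat\omega(\mathbf u_k,\mathbf x_{k-1})+\langle\boldsymbol\lambda^*_{\mathbf u,k},\mathbf h_{\mathbf u,k}(\mathbf u_k)\rangle\}\big)}{\exp(1+\lambda^*_{\mathbf u,0,k})},\qquad k\in\mathcal K,$$ where: (1) $\hat\omega$ is generated by the backward recursion $\hat\omega(\mathbf u_k,\mathbf x_{k-1})=\hat\alpha(\mathbf u_k,\mathbf x_{k-1})+\hat\beta(\mathbf u_k,\mathbf x_{k-1})$ with $$\hat\alpha(\mathbf u_k,\mathbf x_{k-1}):=\mathcal D_{\mathrm{KL}}(\tilde f_{\mathbf X}^k\|\tilde g_{\mathbf X}^k),\qquad \hat\beta(\mathbf u_k,\mathbf x_{k-1}):=-\mathbb E_{\tilde f_{\mathbf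 X}^k}\big[\ln\hat\gamma(\mathbf X_k)\big],$$ and terminal conditions $\hat\beta(\mathbf u_n,\mathbf x_{n-1})=0$, $\hat\alpha(\mathbf u_n,\mathbf x_{n-1})=\mathcal D_{\mathrm{KL}}(\tilde f_{\mathbf X}^n\|\tilde g_{\mathbf X}^n)$; (2) for $k\in\mathcal K$, $\hat\gamma$ is given by $$\ln\hat\gamma(\mathbf x_{k-1}):=\sum_{i=0}^{c_{\mathbf u,k}}\ln\hat\gamma_{\mathbf u,i,k}(\mathbf x_{k-1}),$$ $$\hat\gamma_{\mathbf u,0,k}(\mathbf x_{k-1})=\exp\{\lambda^*_{\mathbf u,0,k}+1\},\qquad \hat\gamma_{\mathbf u,i,k}(\mathbf x_{k-1}):=\exp\{\lambda^*_{\mathbf u,i,k}\,H_{\mathbf u,i,k}\},\ i=1,\dots,c_{\mathbf u,k},$$ with terminal condition $\hat\gamma(\mathbf x_n)=1$ (consistent with $\hat\beta(\mathbf u_n,\mathbf x_{n-1})=0$); (3) $\lambda^*_{\mathbf u,0,k}$ and $\boldsymbol\lambda^*_{\mathbf u,k}=[\lambda^*_{\mathbf u,1,k},\dots,\lambda^*_{\mathbf u,c_{\mathbf u,k},k}]^T$ (which may depend on $\mathbf x_{k-1}$) are the Lagrange multipliers associated to the constraints at time $t_k$; in particular $$\lambda^*_{\mathbf u,0,k}=\ln\Big[\int\tilde g_{\mathbf U}^k\,\exp\big(-\{\hat\omega(\mathbf u_k,\mathbf x_{k-1})+\langle\boldsymbol\lambda^*_{\mathbf u,k},\mathbf h_{\mathbf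 u,k}(\mathbf u_k)\rangle\}\big)\,d\mathbf u_k\Big]-1 .$$ Moreover, the corresponding minimum at time $k$ is $$B_k^*=-\mathbb E_{p_{\mathbf X}^{k-1}}\big[\ln\hat\gamma(\mathbf X_{k-1})\big],$$ where $p_{\mathbf X}^{k}:=f(\mathbf x_k)$ denotes the pdf of the state at time $t_k$.
   Context: Pdf conventions: random vectors are upper case, realizations lower case; for a pdf $f$ with support $\mathrm S(f)$, $\mathbb E_f[\mathbf h(\mathbf Z)]:=\int_{\mathrm S(f)}\mathbf h(\mathbf z)f(\mathbf z)\,d\mathbf z$. For pdfs $\phi,g$ with $\phi$ absolutely continuous with respect to $g$, $\mathcal D_{\mathrm{KL}}(\phi\|g):=\int_{\mathrm S(\phi)}\phi\ln(\phi/g)\,d\mathbf z$. $\langle\cdot,\cdot\rangle$ is the inner product. System: time instants $t_0,\dots,t_n$; $\mathbf x_k\in\mathbb R^{d_x}$ and $\mathbf u_k\in\mathbb R^{d_u}$ are state and input at $t_k$. The closed-loop system is described by the joint pdf of $(\mathbf x_0,\mathbf u_1,\mathbf x_1,\dots,\mathbf u_n,\mathbf x_n)$ $$f^n=\Big(\prod_{k=1}^n\tilde f_{\mathbf X}^k\,\tilde f_{\mathbf U}^k\Big)f_0,\quad \tilde f_{\mathbf X}^k:=f(\mathbf x_k|\mathbf u_k,\mathbf x_{k-1}),\ \tilde f_{\mathbf U}^k:=f(\mathbf u_k|\mathbf x_{k-1}),\ f_0:=f(\mathbf x_0).$$ The $\tilde f_{\mathbf X}^k$ (plant) and $f_0$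 are given; the $\tilde f_{\mathbf U}^k$ (randomized control policies) are the decision variables. The given reference pdf is $$g^n=\Big(\prod_{k=1}^n\tilde g_{\mathbf X}^k\,\tilde g_{\mathbf U}^k\Big)g_0,\quad \tilde g_{\mathbf X}^k:=g(\mathbf x_k|\mathbf u_k,\mathbf x_{k-1}),\ \tilde g_{\mathbf U}^k:=g(\mathbf u_k|\mathbf x_{k-1}),\ g_0:=g(\mathbf x_0).$$ $f^k$ and $g^k$ denote the analogous joint pdfs up to time $t_k$. Constraints: at each time $t_k$ there are $c_{\mathbf u,k}$ constraints plus a normalization. $\tilde{\mathbf H}_{\mathbf u,k}=[H_{\mathbf u,0,k},\mathbf H_{\mathbf u,k}^T]^T$ with $H_{\mathbf u,0,k}=1$ and $\mathbf H_{\mathbf u,k}=[H_{\mathbf u,1,k},\dots,H_{\mathbf u,c_{\mathbf u,k},k}]^T\in\mathbb R^{c_{\mathbf u,k}}$ a constant vector; $\tilde{\mathbf h}_{\mathbf u,k}=[h_{\mathbf u,0,k},\mathbf h_{\mathbf u,k}^T]^T$ with $h_{\mathbf u,0,k}=\mathbb 1_{\mathcal U_k}$ the indicator function of the support $\mathcal U_k$ of the input (so this component enforces that $\tilde f_{\mathbf U}^k$ is a conditional pdf) and $\mathbf h_{\mathbf u,k}:\mathrm S(\tilde f_{\mathbf U}^k)\to\mathbb R^{c_{\mathbf u,k}}$. The constraint at time $t_k$ reads $\int\tilde f_{\mathbf U}^k\,\tilde{\mathbf h}_{\mathbf u,k}(\mathbf u)\,d\mathbf u=\tilde{\mathbf H}_{\mathbf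 u,k}$ (for each fixed $\mathbf x_{k-1}$). Algebraic independence: functions $\mathbf h:\mathcal Z\to\mathbb R^{c}$ are algebraically independent if there is a subset $S\subset\mathcal Z$ of non-zero (Lebesgue) measure such that $\int_S\langle\mathbf v,\mathbf h(\mathbf z)\rangle^2\,d\mathbf z>0$ for all $\mathbf v\in\mathbb R^{c}\setminus\{\mathbf 0\}$; constraints are algebraically independent when their constraint functions are. Lagrange multipliers associated to the constraints at $t_k$: the real numbers $\lambda^*_{\mathbf u,0,k},\dots,\lambda^*_{\mathbf u,c_{\mathbf u,k},k}$ for which the stated $(\tilde f_{\mathbf U}^k)^*$ satisfies the constraints at $t_k$. Minimum at time $k$: $B_k^*$ is the optimal value of the stage-$k$ sub-problem of the backward recursion, $B_k^*:=\min_{\tilde f_{\mathbf U}^k}\big\{\mathbb E_{f^{k-1}}\big[\mathcal D_{\mathrm{KL}}(\tilde f_{\mathbf X}^k\tilde f_{\mathbf U}^k\|\tilde g_{\mathbf X}^k\tilde g_{\mathbf U}^k)\big]+B_{k+1}^*\big\}$ subject to the constraint at $t_k$, with $B_{n+1}^*:=0$. *)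

(* Defs.v *)
From HB Require Import structures.
From mathcomp Require Import all_boot all_order all_algebra.
From mathcomp Require Import all_classical all_reals all_analysis.

Set Implicit Arguments.
Unset Strict Implicit.
Unset Printing Implicit Defensive.

Import Order.TTheory GRing.Theory Num.Theory.
Import numFieldNormedType.Exports.

Local Open Scope classical_set_scope.
Local Open Scope ring_scope.

(** * k-fold powers of a sigma-finite measure, and Lebesgue measure on R^d *)

Section snoc.
Context d (T : measurableType d) (k : nat).

Definition snoc (p : k.-tuple T * T) : k.+1.-tuple T := [tuple of rcons p.1 p.2].

Definition unsnoc (t : k.+1.-tuple T) : k.-tuple T * T :=
  ([tuple tnth t (widen_ord (leqnSn k) i) | i < k], tnth t ord_max).

Lemma snocK : cancel snoc unsnoc.
Proof.
move=> [s x]; congr (_, _).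
  apply: eq_from_tnth => i; rewrite tnth_mktuple (tnth_nth x) (tnth_nth x) /=.
  by rewrite nth_rcons size_tuple ltn_ord.
by rewrite (tnth_nth x) /= nth_rcons size_tuple ltnn eqxx.
Qed.

Lemma measurable_snoc : measurable_fun [set: k.-tuple T * T] snoc.
Proof.
apply/measurable_fun_tnthP => i.
have [ik|ki] := ltnP i k.
  rewrite (_ : _ \o _ = (@tnth k T ^~ (Ordinal ik)) \o fst).
    by apply: measurableT_comp => //; exact: measurable_tnth.
  apply/funext => -[s x] /=.
  by rewrite (tnth_nth x) (tnth_nth x) /= nth_rcons size_tuple ik.
rewrite (_ : _ \o _ = snd); first exact: measurable_snd.
apply/funext => -[s x] /=.
have ek : i = k :> nat by apply/eqP; rewrite eqn_leq ki andbT -ltnS.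
by rewrite (tnth_nth x) /= nth_rcons size_tuple ek ltnn eqxx.
Qed.

Lemma measurable_unsnoc : measurable_fun [set: k.+1.-tuple T] unsnoc.
Proof.
apply: measurable_fun_pair; last exact: measurable_tnth.
apply/measurable_fun_tnthP => i.
rewrite (_ : _ \o _ = @tnth k.+1 T ^~ (widen_ord (leqnSn k) i)).
  exact: measurable_tnth.
by apply/funext => t /=; rewrite tnth_mktuple.
Qed.

End snoc.

(* [m1 \x m2] under a new head constant: on [m1 \x m2] itself, unification picks
   the sigma-finite structure declared for products of subprobabilities. *)
Section product_sigma_finite.
Context d1 d2 (T1 : measurableType d1) (T2 : measurableType d2) (R : realType).
Variables (m1 : {sigma_finite_measure set T1 -> \bar R})
  (m2 : {sigma_finite_measure set T2 -> \bar R}).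

Definition sf_product : set (T1 * T2) -> \bar R := (m1 \x m2)%E.

HB.instance Definition _ := Measure.on sf_product.

Let sf_product_sigma_finite : sigma_finite setT sf_product.
Proof.
have /sigma_finiteP[F [TF ndF Foo]] := sigma_finiteT m1.
have /sigma_finiteP[G [TG ndG Goo]] := sigma_finiteT m2.
exists (fun n => F n `*` G n).
  rewrite -setXTT TF TG predeqE => -[x y]; split.
    move=> [/= [n _ Fnx] [k _ Gky]]; exists (maxn n k) => //; split.
    - by move: x Fnx; exact/subsetPset/ndF/leq_maxl.
    - by move: y Gky; exact/subsetPset/ndG/leq_maxr.
  by move=> [n _ []/= ? ?]; split; exists n.
move=> k; have [? ?] := Foo k; have [? ?] := Goo k.
split; first exact: measurableX.
by rewrite /sf_product product_measure1E// lte_mul_pinfty// ge0_fin_numE.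
Qed.

HB.instance Definition _ := Measure_isSigmaFinite.Build _ _ _ sf_product
  sf_product_sigma_finite.

End product_sigma_finite.

Section power_step.
Context d (T : measurableType d) (R : realType) (k : nat).
Variables (mk : {sigma_finite_measure set (k.-tuple T) -> \bar R})
  (mu : {sigma_finite_measure set T -> \bar R}).

Definition power_step : set (k.+1.-tuple T) -> \bar R :=
  pushforward (sf_product mk mu) (@snoc d T k).

Let power_step_pre A : measurable A -> measurable (@snoc d T k @^-1` A).
Proof. by move=> mA; rewrite -[X in measurable X]setTI; exact: measurable_snoc. Qed.

Let power_step0 : power_step set0 = 0%E.
Proof. by rewrite /power_step /pushforward preimage_set0 measure0. Qed.

Let power_step_ge0 A : (0 <= power_step A)%E.
Proof. by rewrite /power_step /pushforward; exact: measure_ge0. Qed.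

Let power_step_sigma_additive : semi_sigma_additive power_step.
Proof.
move=> F mF tF mUF; rewrite /power_step /pushforward preimage_bigcup.
apply: measure_semi_sigma_additive.
- by move=> n; exact: power_step_pre.
- apply/trivIsetP => /= i j _ _ ij; rewrite -preimage_setI.
  by move/trivIsetP : tF => /(_ _ _ _ _ ij) ->//; rewrite preimage_set0.
- by rewrite -preimage_bigcup; exact: power_step_pre.
Qed.

HB.instance Definition _ := isMeasure.Build _ _ _ power_step
  power_step0 power_step_ge0 power_step_sigma_additive.

Let power_step_sigma_finite : sigma_finite setT power_step.
Proof.
have [F FT Foo] := sigma_finiteT (sf_product mk mu).
exists (fun n => @unsnoc d T k @^-1` F n).
  by rewrite -preimage_bigcup -FT preimage_setT.
move=> n; have [mFn Fnoo] := Foo n; split.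
  by rewrite -[X in measurable X]setTI; exact: measurable_unsnoc.
rewrite /power_step /pushforward -comp_preimage.
rewrite (_ : _ \o _ = id) ?preimage_id//.
by apply/funext => p /=; rewrite snocK.
Qed.

HB.instance Definition _ := Measure_isSigmaFinite.Build _ _ _ power_step
  power_step_sigma_finite.

End power_step.

Fixpoint power_measure d (T : measurableType d) (R : realType)
    (mu : {sigma_finite_measure set T -> \bar R}) (k : nat) :
    {sigma_finite_measure set (k.-tuple T) -> \bar R} :=
  match k with
  | 0 => @dirac _ _ ([tuple] : 0.-tuple T) R
  | k'.+1 => power_step (power_measure mu k') mu
  end.

(* R^d, with the product (= Borel) sigma-algebra *)
Notation Rvec R d := (d.-tuple (measurableTypeR R)).

Definition lebesgue (R : realType) (d : nat) :
    {sigma_finite_measure set (Rvec R d) -> \bar R} :=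
  power_measure (@lebesgue_measure R) d.

(** * Densities, expectations, Kullback-Leibler divergence *)

Section densities.
Context d (T : measurableType d) (R : realType).
Implicit Types (mu : set T -> \bar R) (f phi g : T -> R).

Definition pdf_support f : set T := [set z | f z != 0].

Definition is_pdf mu f :=
  [/\ measurable_fun [set: T] f, forall z, 0 <= f z &
      (\int[mu]_z (f z)%:E = 1)%E].

Definition pdf_expectation mu f (h : T -> \bar R) : \bar R :=
  (\int[mu]_(z in pdf_support f) (h z * (f z)%:E))%E.

Definition pdf_abs_continuous mu phi g :=
  forall A : set T, measurable A ->
    (\int[mu]_(z in A) (g z)%:E = 0 -> \int[mu]_(z in A) (phi z)%:E = 0)%E.

(* extended by +oo to pairs of pdfs without absolute continuity *)
Definition KL mu phi g : \bar R :=
  if `[< pdf_abs_continuous mu phi g >]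
  then (\int[mu]_(z in pdf_support phi) (phi z * ln (phi z / g z))%:E)%E
  else +oo%E.

Definition dotv m (v w : 'cV[R]_m) : R := \sum_(i < m) v i 0 * w i 0.

Definition alg_independent mu m (Z : set T) (h : T -> 'cV[R]_m) :=
  exists S : set T, [/\ measurable S, S `<=` Z, mu S != 0%E &
    forall v : 'cV[R]_m, v != 0 ->
      (0 < \int[mu]_(z in S) (dotv v (h z) ^+ 2)%:E)%E].

End densities.

(* f z s is the conditional density of z given s *)
Definition is_cond_pdf d d' (T : measurableType d) (S : measurableType d')
    (R : realType) (mu : set T -> \bar R) (f : T -> S -> R) :=
  measurable_fun [set: T * S] (fun p => f p.1 p.2) /\
  forall s, is_pdf mu (f ^~ s).

(** * The constrained control problem *)

(* Time indices k are the natural numbers with 0 < k <= horizon; the values of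
   the families below at other indices play no role.
   f_X k x (u, y) is f(x_k = x | u_k = u, x_{k-1} = y), and similarly for g_X;
   g_U k u y is g(u_k = u | x_{k-1} = y). *)
Record control_problem d1 d2 (X : measurableType d1) (U : measurableType d2)
    (R : realType) (muX : {sigma_finite_measure set X -> \bar R})
    (muU : {sigma_finite_measure set U -> \bar R}) := ControlProblem {
  horizon : nat;
  f_0 : X -> R;
  f_X : nat -> X -> U * X -> R;
  g_0 : X -> R;
  g_X : nat -> X -> U * X -> R;
  g_U : nat -> U -> X -> R;
  U_dom : nat -> set U;
  nc : nat -> nat;
  h_u : forall k, U -> 'cV[R]_(nc k);
  H_u : forall k, 'cV[R]_(nc k);
  f_0_pdf : is_pdf muX f_0;
  f_X_pdf : forall k, (0 < k <= horizon)%N -> is_cond_pdf muX (f_X k);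
  g_0_pdf : is_pdf muX g_0;
  g_X_pdf : forall k, (0 < k <= horizon)%N -> is_cond_pdf muX (g_X k);
  g_U_pdf : forall k, (0 < k <= horizon)%N -> is_cond_pdf muU (g_U k);
  U_dom_measurable : forall k, (0 < k <= horizon)%N -> measurable (U_dom k);
  h_u_measurable : forall k, (0 < k <= horizon)%N ->
    forall i, measurable_fun (U_dom k) (fun u => h_u k u i 0)
}.

Section trajectories.
Context d1 d2 (X : measurableType d1) (U : measurableType d2) (R : realType).
Variables (muX : {sigma_finite_measure set X -> \bar R})
  (muU : {sigma_finite_measure set U -> \bar R}).

(* (x_0, [:: (u_1, x_1); ...; (u_k, x_k)]) *)
Local Notation traj k := (X * k.-tuple (U * X))%type.

Definition traj_measure (k : nat) : {sigma_finite_measure set (traj k) -> \bar R} :=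
  sf_product muX (power_measure (sf_product muU muX) k).

Definition state k (p : traj k) (j : nat) : X :=
  nth p.1 (p.1 :: [seq w.2 | w <- p.2]) j.

(* the joint pdf of (x_0, u_1, x_1, ..., u_k, x_k) *)
Definition joint_pdf (tX : nat -> X -> U * X -> R) (tU : nat -> U -> X -> R)
    (t0 : X -> R) (k : nat) (p : traj k) : R :=
  (\prod_(i < k) (let w := tnth p.2 i in
     tX i.+1 w.2 (w.1, state p i) * tU i.+1 w.1 (state p i))) * t0 p.1.

(* the marginal pdf of x_k *)
Definition state_pdf (tX : nat -> X -> U * X -> R) (tU : nat -> U -> X -> R)
    (t0 : X -> R) (k : nat) (x : X) : R :=
  match k with
  | 0 => t0 x
  | j.+1 => fine (\int[sf_product (traj_measure j) muU]_q
      (@joint_pdf tX tU t0 j.+1 (q.1.1, snoc (q.1.2, (q.2, x))))%:E)%E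
  end.

End trajectories.

Section control.
Context d1 d2 (X : measurableType d1) (U : measurableType d2) (R : realType).
Context (muX : {sigma_finite_measure set X -> \bar R})
  (muU : {sigma_finite_measure set U -> \bar R}).
Variable P : control_problem muX muU.

Local Notation n := (horizon P).

Definition h_tilde k (u : U) : 'cV[R]_(1 + nc P k) :=
  col_mx (\1_(U_dom P k) u)%:M (h_u P k u).

Definition H_tilde k : 'cV[R]_(1 + nc P k) := col_mx 1%:M (H_u P k).

Definition satisfies_constraints k (pi : U -> X -> R) :=
  forall x i, pdf_expectation muU (pi ^~ x) (fun u => (h_tilde k u i 0)%:E) =
              (H_tilde k i 0)%:E.

(* The normalization of [pi] is component 0 of the constraints. *)
Definition feasible_at k (pi : U -> X -> R) :=
  [/\ measurable_fun [set: U * X] (fun p => pi p.1 p.2),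
      forall u x, 0 <= pi u x,
      forall x, pdf_support (pi ^~ x) `<=` U_dom P k &
      satisfies_constraints k pi].

Definition f_joint (fU : nat -> U -> X -> R) k : X * k.-tuple (U * X) -> R :=
  @joint_pdf _ _ _ _ _ (f_X P) fU (f_0 P) k.

Definition g_joint k : X * k.-tuple (U * X) -> R :=
  @joint_pdf _ _ _ _ _ (g_X P) (g_U P) (g_0 P) k.

Definition p_X (fU : nat -> U -> X -> R) k : X -> R :=
  state_pdf muX muU (f_X P) fU (f_0 P) k.

Definition cost (fU : nat -> U -> X -> R) : \bar R :=
  KL (traj_measure muX muU n) (f_joint fU (k := n)) (g_joint (k := n)).

Definition feasible (fU : nat -> U -> X -> R) :=
  forall k, (0 < k <= n)%N -> feasible_at k (fU k).

Definition is_solution (fU : nat -> U -> X -> R) :=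
  feasible fU /\ forall fU', feasible fU' -> (cost fU <= cost fU')%E.

Definition stage_cost k (fU : nat -> U -> X -> R) (pi : U -> X -> R) : \bar R :=
  pdf_expectation (traj_measure muX muU k.-1) (f_joint fU (k := k.-1)) (fun p =>
    let y := state p k.-1 in
    KL (sf_product muU muX) (fun w => f_X P k w.2 (w.1, y) * pi w.1 y)
                            (fun w => g_X P k w.2 (w.1, y) * g_U P k w.1 y)).

(* The optimal value of the sub-problem at time k, when m stages (k, ..., k+m-1)
   are left; it depends on the policies [fU j], j < k, through f^{k-1}. *)
Fixpoint B_rec (m k : nat) (fU : nat -> U -> X -> R) : \bar R :=
  match m with
  | 0 => 0%E
  | m'.+1 => ereal_inf [set (stage_cost k fU pi
                 + B_rec m' k.+1 [eta fU with k |-> pi])%E | pi in feasible_at k]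
  end.

Definition B_star k := B_rec (n.+1 - k) k.

Section multipliers.
(* lam0 k y and lam k y are the multipliers at time k given x_{k-1} = y. *)
Variables (lam0 : nat -> X -> R) (lam : forall k, X -> 'cV[R]_(nc P k)).

Definition gamma_u0 k (y : X) : R := expR (lam0 k y + 1).

Definition gamma_u k (i : 'I_(nc P k)) (y : X) : R :=
  expR (lam k y i 0 * H_u P k i 0).

(* gamma_hat j is the function of x_j, built from the multipliers at time j+1 *)
Definition gamma_hat j (x : X) : R :=
  if (j < n)%N
  then expR (ln (gamma_u0 j.+1 x) + \sum_(i < nc P j.+1) ln (gamma_u i x))
  else 1.

Definition alpha_hat k (w : U * X) : \bar R :=
  KL muX (f_X P k ^~ w) (g_X P k ^~ w).

Definition beta_hat k (w : U * X) : \bar R :=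
  (- pdf_expectation muX (f_X P k ^~ w) (fun x => (ln (gamma_hat k x))%:E))%E.

Definition omega_hat k (w : U * X) : \bar R := (alpha_hat k w + beta_hat k w)%E.

(* exp(-{omega_hat + <lam, h>}), equal to 0 where omega_hat = +oo *)
Definition tilt k (u : U) (y : X) : \bar R :=
  expeR (- (omega_hat k (u, y) + (dotv (lam k y) (h_u P k u))%:E))%E.

Definition f_star k (u : U) (y : X) : R :=
  if u \in U_dom P k
  then g_U P k u y * (fine (tilt k u y) / expR (1 + lam0 k y))
  else 0.

Definition are_multipliers :=
  forall k, (0 < k <= n)%N ->
  [/\ measurable_fun [set: X] (lam0 k),
      forall i, measurable_fun [set: X] (fun y => lam k y i 0) &
      satisfies_constraints k (f_star k)].

End multipliers.

End control.

(* Main.v *)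
(** Write V_j = - ln gamma_hat_j. If [pi] satisfies the constraints at time k,
    then, since <lam, h> integrates to <lam, H> against [pi],
      KL(pi || g_U) + E_pi[omega_hat] = KL(pi || f_star) + V_(k-1)(x_(k-1)).
    With pi = f_star this gives V_(k-1) >= 0 by backward induction, so that all
    the expectations involved are those of nonnegative functions. By the chain
    rule for the divergence, averaging over trajectories yields
      stage cost + E[V_k] = E[KL(pi || f_star)] + E[V_(k-1)],
    which gives the values B_k, and, telescoping,
      cost = KL(f_0 || g_0) + E[V_0] + sum_k E[KL(pi_k || f_star_k)],
    hence optimality of f_star and uniqueness. *)

Require Import Defs.
From HB Require Import structures.
From mathcomp Require Import all_boot all_order all_algebra.
From mathcomp Require Import all_classical all_reals all_analysis.
From mathcomp Require Import measurable_realfun ring lra.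

Set Implicit Arguments.
Unset Strict Implicit.
Unset Printing Implicit Defensive.

Import Order.TTheory GRing.Theory Num.Theory.
Import numFieldNormedType.Exports.

Local Open Scope classical_set_scope.
Local Open Scope ring_scope.

(** Divergences and [omega_hat] may be [+oo], and the integrand of a divergence has both signs, so
    the identities cannot be obtained by subtracting integrals or by a Fubini theorem for integrable
    functions. This is the reason for [kl_integrand]: every divergence of pdfs becomes the integral
    of a nonnegative function, Tonelli's theorem applies without finiteness conditions, identities
    are stated between sums, and only finite quantities (mostly total masses equal to 1) are ever
    cancelled. The one signed term left is the multiplier term, and it is integrable because the
    constraints give its integral a finite value. The sign of V_k is what carries this scheme
    through the recursion: [beta_hat] is the conditional mean of V_k, so V_k >= 0 makes [omega_hat]
    nonnegative, which keeps the tilt finite and lets [alpha_hat] and [beta_hat] be averaged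
    separately. Finiteness of the cost matters for uniqueness alone, where the constant part of the
    cost has to be cancelled. *)

Lemma measurable_invr (R : realType) : measurable_fun [set: R] (@GRing.inv R).
Proof.
(* Exponent -1 in [powR] gives the inverse on nonnegative bases, hence the detour through the
   square; at 0 both sides are 0. *)
rewrite (_ : GRing.inv = fun x : R => x * (x ^+ 2) `^ (-1)).
  apply: measurable_funM => //.
  by apply: (measurableT_comp (measurable_powR (- 1))) => //; exact: measurable_funX.
apply/funext => x; rewrite powR_inv1 ?sqr_ge0//.
have [->|x0] := eqVneq x 0; first by rewrite invr0 mul0r.
by rewrite expr2 invfM mulrA divff// mul1r.
Qed.

(** * Divergence *)

Section kl_integrand.
Context {R : realType}.
Implicit Types a b p q : R.
Local Open Scope ereal_scope.

(* The integrand [a ln(a/b)] of the divergence, shifted by [b - a] so that it is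
   nonnegative; for pdfs the shift integrates to 0. *)
Definition kl_integrand a b : \bar R :=
  if a == 0%R then b%:E else
  if b == 0%R then +oo else (a * ln (a / b) - a + b)%:E.

(** This is ln t <= t - 1 at t = b/a, multiplied by a. It yields the nonnegativity of the shifted
    integrand and, in [KLE], the bound on the negative part of a ln(a/b). *)
Lemma subr_le_mul_ln a b : (0 < a)%R -> (0 < b)%R -> (a - b <= a * ln (a / b))%R.
Proof.
move=> a0 b0; have ba0 : (0 < b / a)%R by rewrite divr_gt0.
have h : (ln (b / a) <= b / a - 1)%R.
  have := @le_ln1Dx R (b / a - 1); rewrite addrCA subrr addr0; apply.
  by rewrite ltrBrDl subrr.
have -> : ln (a / b) = (- ln (b / a))%R.
  by rewrite !ln_div ?posrE// opprB.
rewrite mulrN lerNr opprB.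
apply: le_trans (ler_wpM2l (ltW a0) h) _.
by rewrite mulrBr mulr1 mulrCA divff ?mulr1// gt_eqF.
Qed.

Lemma kl_integrand_ge0 a b : (0 <= a)%R -> (0 <= b)%R -> 0 <= kl_integrand a b.
Proof.
move=> a0 b0; rewrite /kl_integrand; case: eqVneq => [_|an0]; first by rewrite lee_fin.
case: eqVneq => [//|bn0]; rewrite lee_fin.
have := @subr_le_mul_ln a b; rewrite !lt_neqAle eq_sym an0 eq_sym bn0 a0 b0/=.
by move=> /(_ isT isT); lra.
Qed.

Lemma kl_integrandxx a : kl_integrand a a = 0.
Proof.
rewrite /kl_integrand; case: eqVneq => [->//|a0].
by rewrite divff// ln1 mulr0 add0r addNr.
Qed.

(** Strict form of the same inequality: exp s > 1 + s at s = ln(b/a), which is nonzero when a and b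
    are positive and distinct. *)
Lemma kl_integrand_eq0 a b : (0 <= a)%R -> (0 <= b)%R ->
  kl_integrand a b = 0 -> a = b.
Proof.
move=> a0 b0; rewrite /kl_integrand; case: eqVneq => [-> [->//]|an0].
case: eqVneq => // bn0 [].
have {an0}a0 : (0 < a)%R by rewrite lt_neqAle eq_sym an0.
have {bn0}b0 : (0 < b)%R by rewrite lt_neqAle eq_sym bn0.
have ba0 : (0 < b / a)%R by rewrite divr_gt0.
have -> : ln (a / b) = (- ln (b / a))%R by rewrite !ln_div ?posrE// opprB.
rewrite mulrN => e.
have [//|ab] := eqVneq a b; exfalso.
have /expR_gt1Dx : ln (b / a) != 0%R.
  rewrite ln_eq0// -subr_eq0.
  have -> : (b / a - 1 = (b - a) / a)%R by rewrite mulrBl divff// gt_eqF.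
  by rewrite mulf_eq0 invr_eq0 subr_eq0 negb_or eq_sym ab gt_eqF.
rewrite lnK ?posrE// -(ltr_pM2l a0) mulrDr mulr1.
have -> : (a * (b / a) = b)%R by rewrite mulrCA divff ?mulr1// gt_eqF.
by lra.
Qed.

(** The chain rule before integration. Terms are added on both sides rather than subtracted, so that
    the identity survives the value [+oo]. When p, q are pdfs and a, b conditional pdfs, each of the
    four added products is a joint pdf of mass 1. *)
Lemma kl_integrandM a b p q :
  (0 <= a)%R -> (0 <= b)%R -> (0 <= p)%R -> (0 <= q)%R ->
  kl_integrand (p * a) (q * b) + ((p * b)%:E + (q * a)%:E) =
  p%:E * kl_integrand a b + a%:E * kl_integrand p q + ((p * a)%:E + (q * b)%:E).
Proof.
move=> a0 b0 p0 q0; rewrite /kl_integrand !mulf_eq0.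
have [->|pn0] := eqVneq p 0%R.
  by rewrite /= !mul0r mul0e add0e -!EFinM -!EFinD; congr (_%:E); ring.
have [->|an0] := eqVneq a 0%R.
  rewrite /= !mulr0 mul0e adde0 -!EFinD; congr (_%:E); ring.
rewrite /=.
have {an0}a0' : (0 < a)%R by rewrite lt_neqAle eq_sym an0.
have {pn0}p0' : (0 < p)%R by rewrite lt_neqAle eq_sym pn0.
have [->|qn0] := eqVneq q 0%R.
  rewrite /= [in RHS]gt0_muley ?lte_fin//.
  by case: ifP => _; rewrite ?gt0_muley ?lte_fin// -?EFinM.
have [->|bn0] := eqVneq b 0%R.
  by rewrite /= gt0_muley ?lte_fin// -?EFinM.
have {bn0}b0' : (0 < b)%R by rewrite lt_neqAle eq_sym bn0.
have {qn0}q0' : (0 < q)%R by rewrite lt_neqAle eq_sym qn0.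
rewrite /= -!EFinM -!EFinD; congr (_%:E).
by rewrite !ln_div ?posrE ?mulr_gt0// !lnM ?posrE//; ring.
Qed.

Lemma measurable_kl_integrand d (T : measurableType d) (f g : T -> R) :
  measurable_fun [set: T] f -> measurable_fun [set: T] g ->
  measurable_fun [set: T] (fun z => kl_integrand (f z) (g z)).
Proof.
move=> mf mg; rewrite /kl_integrand.
apply: measurable_fun_ifT; first exact: measurable_fun_eqr.
  exact/measurable_EFinP.
apply: measurable_fun_ifT; [exact: measurable_fun_eqr|exact: measurable_cst|].
apply/measurable_EFinP/measurable_funD => //; apply: measurable_funB => //.
apply: measurable_funM => //; apply: measurableT_comp; first exact: measurable_ln.
by apply: measurable_funM => //; apply: measurableT_comp => //; exact: measurable_invr.
Qed.

End kl_integrand.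

(** * Divergence as the integral of a nonnegative function *)

Section divergence.
Context d (T : measurableType d) (R : realType) (mu : {measure set T -> \bar R}).
Local Open Scope ereal_scope.

(** [A] and [B] may have infinite integrals. The negative part of [phi], moved to the side of [A],
    leaves an equality of nonnegative functions, where integration is additive unconditionally; its
    finite integral is then subtracted again. *)
Lemma integral_adde_real (A B : T -> \bar R) (phi : T -> R) :
  measurable_fun [set: T] A -> measurable_fun [set: T] B ->
  measurable_fun [set: T] phi ->
  (forall z, 0 <= A z) -> (forall z, 0 <= B z) ->
  \int[mu]_z (EFin \o phi)^\- z < +oo ->
  {ae mu, forall z, A z = B z + (phi z)%:E} ->
  \int[mu]_z A z = \int[mu]_z B z + \int[mu]_z (EFin \o phi) z.
Proof.
move=> mA mB mphi A0 B0 fin eqAB.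
have mp : measurable_fun [set: T] (EFin \o phi)^\+.
  exact/measurable_funepos/measurable_EFinP.
have mn : measurable_fun [set: T] (EFin \o phi)^\-.
  exact/measurable_funeneg/measurable_EFinP.
have : \int[mu]_z (A z + (EFin \o phi)^\- z) = \int[mu]_z (B z + (EFin \o phi)^\+ z).
  apply: ge0_ae_eq_integral => //.
  - exact: emeasurable_funD.
  - exact: emeasurable_funD.
  - by move=> x _; rewrite adde_ge0.
  - by move=> x _; rewrite adde_ge0.
  apply: filterS eqAB => z /= -> _.
  rewrite -addeA; congr (_ + _).
  rewrite [(phi z)%:E](congr1 (@^~ z) (funeposneg (EFin \o phi))).
  by rewrite subeK// funenegE /= -EFin_max.
rewrite !ge0_integralD// (integralE _ _ (EFin \o phi)).
move=> /(congr1 (fun x => x - \int[mu]_z (EFin \o phi)^\- z)).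
rewrite addeK; last by rewrite ge0_fin_numE// integral_ge0.
by move=> ->; rewrite addeA.
Qed.

Lemma integral_pdf_support (f : T -> R) (h : T -> \bar R) :
  (forall z, f z = 0%R -> h z = 0) ->
  \int[mu]_(z in pdf_support f) h z = \int[mu]_z h z.
Proof.
move=> h0; rewrite integral_mkcond; apply: eq_integral => z _.
rewrite patchE; case: ifPn => //; rewrite notin_setE /pdf_support /= => /negP.
by rewrite negbK => /eqP /h0.
Qed.

Lemma pdf_expectationE (f : T -> R) (h : T -> \bar R) :
  pdf_expectation mu f h = \int[mu]_z (h z * (f z)%:E).
Proof. by apply: integral_pdf_support => z ->; rewrite mule0. Qed.

(** The shift g - phi integrates to 1 - 1. Absolute continuity confines the case g = 0 < phi to a
    null set; without it this case has positive measure and the integral is [+oo], in agreement with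
    the convention in [KL]. *)
Lemma KLE (phi g : T -> R) : is_pdf mu phi -> is_pdf mu g ->
  KL mu phi g = \int[mu]_z kl_integrand (phi z) (g z).
Proof.
move=> [mphi phi0 phi1] [mg g0 g1].
have kl0 z : 0 <= kl_integrand (phi z) (g z) by apply: kl_integrand_ge0.
have mkl := measurable_kl_integrand mphi mg.
rewrite /KL; case: asboolP => [ac|nac].
  have mg0 : measurable [set z | g z = 0%R].
    by rewrite -[X in measurable X]setTI; exact: (mg measurableT [set 0%R]).
  have /ac : \int[mu]_(z in [set z | g z = 0%R]) (g z)%:E = 0.
    by apply: integral0_eq => z /= ->.
  move=> /(_ mg0) phiN.
  have {phiN}phiN : {ae mu, forall z, g z = 0%R -> phi z = 0%R}.
    have /ae_eq_integral_abs : measurable_fun [set z | g z = 0%R] (EFin \o phi).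
      by apply: measurable_funTS; exact/measurable_EFinP.
    move=> /(_ mu mg0) [+ _]; rewrite (eq_integral (fun z => (phi z)%:E)); last first.
      by move=> z _; rewrite /= ger0_norm.
    by move=> /(_ phiN); apply: filterS => z /= h /h [].
  rewrite integral_pdf_support; last by move=> z ->; rewrite mul0r.
  have mL : measurable_fun [set: T] (fun z => phi z * ln (phi z / g z))%R.
    apply: measurable_funM => //; apply: measurableT_comp; first exact: measurable_ln.
    by apply: measurable_funM => //; apply: measurableT_comp => //; exact: measurable_invr.
  have := @integral_adde_real (fun z => kl_integrand (phi z) (g z) + (phi z)%:E)
    (fun z => (g z)%:E) (fun z => phi z * ln (phi z / g z))%R.
  rewrite ge0_integralD//; last 2 first.
  - by move=> z _; rewrite lee_fin.
  - exact/measurable_EFinP.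
  rewrite g1 phi1 [RHS]addeC => h.
  apply/esym; rewrite -[LHS](addeK _ (_ : 1 \is a fin_num))//.
  rewrite -[RHS](addeK _ (_ : 1 \is a fin_num))//; congr (_ - _).
  apply: h => //.
  - by apply: emeasurable_funD => //; exact/measurable_EFinP.
  - exact/measurable_EFinP.
  - by move=> z; rewrite adde_ge0// lee_fin.
  (* The negative part of phi ln(phi/g) is almost everywhere at most g, because phi ln(phi/g) >= phi
     - g >= -g. *)
  - apply: (@le_lt_trans _ _ (\int[mu]_z (g z)%:E)); last by rewrite g1 ltry.
    apply: ae_ge0_le_integral => //.
    + exact/measurable_funeneg/measurable_EFinP.
    + by move=> z _; rewrite lee_fin.
    + exact/measurable_EFinP.
    apply: filterS phiN => z hz _; rewrite funenegE /= -EFin_max lee_fin ge_max g0 andbT.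
    have [/hz ->|gz] := eqVneq (g z) 0%R; first by rewrite mul0r oppr0.
    have [->|pz] := eqVneq (phi z) 0%R; first by rewrite mul0r oppr0.
    have := @subr_le_mul_ln _ (phi z) (g z).
    rewrite !lt_neqAle !(eq_sym 0%R) pz gz phi0 g0 => /(_ isT isT).
    by have := phi0 z; lra.
  apply: filterS phiN => z hz; rewrite /kl_integrand.
  case: eqVneq => [->|pz]; first by rewrite mul0r.
  case: eqVneq => [/hz/eqP|gz]; first by rewrite (negbTE pz).
  by rewrite -!EFinD; congr (_%:E); ring.
(* By contraposition: a finite integral makes the integrand finite almost everywhere, so phi = 0
   almost everywhere on g = 0, which is absolute continuity. *)
have [//|fin] := eqVneq (\int[mu]_z kl_integrand (phi z) (g z)) +oo.
exfalso; apply: nac => A mA gA.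
have /integrable_ae : mu.-integrable [set: T] (fun z => kl_integrand (phi z) (g z)).
  apply/integrableP; split => //.
  under eq_integral do rewrite gee0_abs//.
  by rewrite ltey.
move=> /(_ measurableT) klfin.
have gN : {ae mu, forall z, A z -> (g z)%:E = 0}.
  apply/ae_eq_integral_abs => //; first exact/measurable_funTS/measurable_EFinP.
  by rewrite -[RHS]gA; apply: eq_integral => z _; rewrite /= ger0_norm.
rewrite (ae_eq_integral (cst 0)) ?integral0//; first exact/measurable_funTS/measurable_EFinP.
apply: filterS2 klfin gN => z klz gz /gz [] gz0.
have := klz I; rewrite /kl_integrand gz0 eqxx; case: eqVneq => [->//|//].
Qed.

Lemma KL_ge0 (phi g : T -> R) : is_pdf mu phi -> is_pdf mu g -> 0 <= KL mu phi g.
Proof.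
move=> p q; rewrite KLE//; apply: integral_ge0 => z _.
by case: p q => _ + _ [_ + _] => ? ?; exact: kl_integrand_ge0.
Qed.

Lemma KLxx (phi : T -> R) : is_pdf mu phi -> KL mu phi phi = 0.
Proof. by move=> p; rewrite KLE//; apply: integral0_eq => z _; rewrite kl_integrandxx. Qed.

Lemma KL_eq0 (phi g : T -> R) : is_pdf mu phi -> is_pdf mu g ->
  KL mu phi g = 0 -> {ae mu, forall z, phi z = g z}.
Proof.
move=> p q; rewrite KLE//; case: p q => mphi phi0 _ [mg g0 _] kl0.
have /ae_eq_integral_abs := measurable_kl_integrand mphi mg.
move=> /(_ mu measurableT)[+ _]; under eq_integral do rewrite gee0_abs ?kl_integrand_ge0//.
by move=> /(_ kl0); apply: filterS => z /(_ I); exact: kl_integrand_eq0.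
Qed.

End divergence.

(** * Conditional densities on product spaces and the chain rule *)

Section product.
Context d1 d2 (S : measurableType d1) (T : measurableType d2) (R : realType).
Variables (m1 : {sigma_finite_measure set S -> \bar R})
  (m2 : {sigma_finite_measure set T -> \bar R}).
Local Open Scope ereal_scope.

Lemma integral_sf_product (f : S * T -> \bar R) :
  measurable_fun [set: S * T] f -> (forall z, 0 <= f z) ->
  \int[sf_product m1 m2]_z f z = \int[m1]_x \int[m2]_y f (x, y).
Proof. exact: fubini_tonelli1. Qed.

Lemma measurable_integral_snd (f : S * T -> \bar R) :
  measurable_fun [set: S * T] f -> (forall z, 0 <= f z) ->
  measurable_fun [set: S] (fun x => \int[m2]_y f (x, y)).
Proof. exact: measurable_fun_fubini_tonelli_F. Qed.

Lemma measurable_cond_pdf (a : T -> S -> R) : is_cond_pdf m2 a ->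
  measurable_fun [set: S * T] (fun z => a z.2 z.1).
Proof.
move=> [ma _]; apply: (measurableT_comp ma (g := fun z : S * T => (z.2, z.1))).
by apply: measurable_fun_pair; [exact: measurable_snd|exact: measurable_fst].
Qed.

Lemma integral_mul_cond_pdf (p : S -> R) (a : T -> S -> R) (h : S * T -> \bar R) :
  measurable_fun [set: S] p -> (forall s, 0 <= p s)%R -> is_cond_pdf m2 a ->
  measurable_fun [set: S * T] h -> (forall z, 0 <= h z) ->
  \int[sf_product m1 m2]_z (h z * (p z.1 * a z.2 z.1)%:E) =
  \int[m1]_s ((\int[m2]_t (h (s, t) * (a t s)%:E)) * (p s)%:E).
Proof.
move=> mp p0 pa mh h0; have ma := measurable_cond_pdf pa.
have a0 t s : (0 <= a t s)%R by case: pa => _ /(_ s)[].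
rewrite integral_sf_product; last 2 first.
- apply: emeasurable_funM => //; apply/measurable_EFinP/measurable_funM => //.
  by apply: (measurableT_comp mp); exact: measurable_fst.
- by move=> z; rewrite mule_ge0// lee_fin mulr_ge0.
apply: eq_integral => s _ /=.
under eq_integral do rewrite mulrC EFinM muleA.
rewrite ge0_integralZr//; last 2 first.
- by move=> t _; rewrite mule_ge0// lee_fin.
- by rewrite lee_fin.
apply: emeasurable_funM; first exact: measurableT_comp (pair1_measurable s).
by apply/measurable_EFinP; exact: measurableT_comp ma (pair1_measurable s).
Qed.

Lemma is_pdf_mul_cond (p : S -> R) (a : T -> S -> R) :
  is_pdf m1 p -> is_cond_pdf m2 a ->
  is_pdf (sf_product m1 m2) (fun z => p z.1 * a z.2 z.1)%R.
Proof.
move=> [mp p0 p1] pa; have ma := measurable_cond_pdf pa.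
have a0 t s : (0 <= a t s)%R by case: pa => _ /(_ s)[].
split.
- apply: measurable_funM => //.
  by apply: (measurableT_comp mp); exact: measurable_fst.
- by move=> z; rewrite mulr_ge0.
transitivity (\int[sf_product m1 m2]_z (cst 1 z * (p z.1 * a z.2 z.1)%:E)).
  by apply: eq_integral => z _; rewrite /= mul1e.
rewrite integral_mul_cond_pdf// -[RHS]p1; apply: eq_integral => s _.
case: pa => _ /(_ s)[_ _ as1].
rewrite (eq_integral (fun t => (a t s)%:E)) => [|t _].
  by rewrite as1 mul1e.
by rewrite /= mul1e.
Qed.

Lemma measurable_KL_cond (a b : T -> S -> R) :
  is_cond_pdf m2 a -> is_cond_pdf m2 b ->
  measurable_fun [set: S] (fun s => KL m2 (a ^~ s) (b ^~ s)).
Proof.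
move=> pa pb.
have ma := measurable_cond_pdf pa; have mb := measurable_cond_pdf pb.
pose k (z : S * T) := kl_integrand (a z.2 z.1) (b z.2 z.1).
rewrite (_ : (fun s => _) = fun s => \int[m2]_t k (s, t)).
  apply: (@measurable_integral_snd k); first exact: measurable_kl_integrand.
  move=> z; apply: kl_integrand_ge0.
    by case: pa => _ /(_ z.1)[].
  by case: pb => _ /(_ z.1)[].
by apply/funext => s; rewrite KLE//; [case: pa => _|case: pb => _].
Qed.

(** Integrate [kl_integrandM]: the added terms amount to 1 + 1 on each side and cancel even if the
    divergences are infinite. In the term a(t|s) times the integrand of KL(p || q) at s, the
    integral over t of a(t|s) is 1. *)
Lemma KL_chain (p q : S -> R) (a b : T -> S -> R) :
  is_pdf m1 p -> is_pdf m1 q -> is_cond_pdf m2 a -> is_cond_pdf m2 b ->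
  KL (sf_product m1 m2) (fun z => p z.1 * a z.2 z.1)%R (fun z => q z.1 * b z.2 z.1)%R =
  KL m1 p q + \int[m1]_s (KL m2 (a ^~ s) (b ^~ s) * (p s)%:E).
Proof.
move=> pp pq pa pb; rewrite !KLE//; [|exact: is_pdf_mul_cond..].
have ma := measurable_cond_pdf pa; have mb := measurable_cond_pdf pb.
have a0 t s : (0 <= a t s)%R by case: pa => _ /(_ s)[].
have b0 t s : (0 <= b t s)%R by case: pb => _ /(_ s)[].
have [mp p0 p1] := pp; have [mq q0 q1] := pq.
have mp' : measurable_fun [set: S * T] (fun z : S * T => p z.1).
  by apply: (measurableT_comp mp); exact: measurable_fst.
have mq' : measurable_fun [set: S * T] (fun z : S * T => q z.1).
  by apply: (measurableT_comp mq); exact: measurable_fst.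
pose k1 (z : S * T) := kl_integrand (a z.2 z.1) (b z.2 z.1).
pose k2 (z : S * T) := kl_integrand (p z.1) (q z.1).
have mk1 : measurable_fun [set: S * T] k1 by exact: measurable_kl_integrand.
have mk2 : measurable_fun [set: S * T] k2 by exact: measurable_kl_integrand.
have k10 z : 0 <= k1 z by exact: kl_integrand_ge0.
have k20 z : 0 <= k2 z by exact: kl_integrand_ge0.
have key : \int[sf_product m1 m2]_z
    (kl_integrand (p z.1 * a z.2 z.1) (q z.1 * b z.2 z.1) +
      ((p z.1 * b z.2 z.1)%:E + (q z.1 * a z.2 z.1)%:E)) =
    \int[sf_product m1 m2]_z ((p z.1)%:E * k1 z + (a z.2 z.1)%:E * k2 z +
      ((p z.1 * a z.2 z.1)%:E + (q z.1 * b z.2 z.1)%:E)).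
  by apply: eq_integral => z _; exact: kl_integrandM.
have [mpa pa0 pa1] := is_pdf_mul_cond pp pa.
have [mpb pb0 pb1] := is_pdf_mul_cond pp pb.
have [mqa qa0 qa1] := is_pdf_mul_cond pq pa.
have [mqb qb0 qb1] := is_pdf_mul_cond pq pb.
have mE (f : S * T -> R) : measurable_fun [set: S * T] f ->
    measurable_fun [set: S * T] (EFin \o f).
  by move=> ?; exact/measurable_EFinP.
have mk : measurable_fun [set: S * T]
    (fun z => kl_integrand (p z.1 * a z.2 z.1) (q z.1 * b z.2 z.1)).
  exact: measurable_kl_integrand.
move: key.
rewrite ge0_integralD; [|exact: measurableT| | | |]; last 4 first.
- by move=> z _; exact: kl_integrand_ge0.
- exact: mk.
- by move=> z _; rewrite adde_ge0// lee_fin.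
- by apply: emeasurable_funD; exact: mE.
rewrite [X in _ + X = _]ge0_integralD; [|exact: measurableT| | | |]; last 4 first.
- by move=> z _; rewrite lee_fin.
- exact: mE.
- by move=> z _; rewrite lee_fin.
- exact: mE.
rewrite pb1 qa1.
rewrite [in RHS]ge0_integralD; [|exact: measurableT| | | |]; last 4 first.
- by move=> z _; rewrite adde_ge0// mule_ge0// lee_fin.
- by apply: emeasurable_funD; apply: emeasurable_funM => //; exact: mE.
- by move=> z _; rewrite adde_ge0// lee_fin.
- by apply: emeasurable_funD; exact: mE.
rewrite [X in _ = _ + X]ge0_integralD; [|exact: measurableT| | | |]; last 4 first.
- by move=> z _; rewrite lee_fin.
- exact: mE.
- by move=> z _; rewrite lee_fin.
- exact: mE.
rewrite pa1 qb1 => key.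
rewrite -[LHS](addeK _ (_ : 1 + 1 \is a fin_num))// key addeK// {key}.
rewrite ge0_integralD; [|exact: measurableT| | | |]; last 4 first.
- by move=> z _; rewrite mule_ge0// ?lee_fin//; exact: k10.
- by apply: emeasurable_funM; [exact: mE|exact: mk1].
- by move=> z _; rewrite mule_ge0// ?lee_fin//; exact: k20.
- by apply: emeasurable_funM; [exact: mE|exact: mk2].
rewrite addeC; congr (_ + _).
  rewrite integral_sf_product; last 2 first.
  - by apply: emeasurable_funM; [exact: mE|exact: mk2].
  - by move=> z; rewrite mule_ge0// ?lee_fin//; exact: k20.
  apply: eq_integral => s _; rewrite /k2 /= ge0_integralZr//.
  - by case: pa => _ /(_ s)[_ _ ->]; rewrite mul1e.
  - by apply/measurable_EFinP; exact: measurableT_comp ma (pair1_measurable s).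
  - by move=> t _; rewrite lee_fin.
  - exact: kl_integrand_ge0.
rewrite integral_sf_product; last 2 first.
- by apply: emeasurable_funM; [exact: mE|exact: mk1].
- by move=> z; rewrite mule_ge0// ?lee_fin//; exact: k10.
apply: eq_integral => s _ /=.
rewrite ge0_integralZl//; last 2 first.
- exact: (measurableT_comp mk1 (pair1_measurable s)).
- by rewrite lee_fin.
by rewrite muleC KLE//; [case: pa => _|case: pb => _].
Qed.

End product.

Lemma is_cond_pdf_comp (R : realType) d3 d4 d5 (T : measurableType d3) (S : measurableType d4)
    (S' : measurableType d5) (mu : set T -> \bar R) (a : T -> S -> R) (f : S' -> S) :
  measurable_fun [set: S'] f -> is_cond_pdf mu a -> is_cond_pdf mu (fun t s => a t (f s)).
Proof.
move=> mf [ma pa]; split => [|s]; last exact: pa.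
apply: (measurableT_comp ma (g := fun z : T * S' => (z.1, f z.2))).
apply: measurable_fun_pair; first exact: measurable_fst.
exact: measurableT_comp mf measurable_snd.
Qed.

(** * Trajectories *)

Section traj.
Context d1 d2 (X : measurableType d1) (U : measurableType d2) (R : realType).
Variables (muX : {sigma_finite_measure set X -> \bar R})
  (muU : {sigma_finite_measure set U -> \bar R}).
Local Notation traj k := (X * k.-tuple (U * X))%type.
Local Notation muT := (traj_measure muX muU).
Local Open Scope ereal_scope.

Definition traj_snoc k (q : traj k * (U * X)) : traj k.+1 :=
  (q.1.1, snoc (q.1.2, q.2)).

Lemma measurable_traj_snoc k : measurable_fun [set: traj k * (U * X)] (@traj_snoc k).
Proof.
apply: measurable_fun_pair.
  exact: measurableT_comp measurable_fst measurable_fst.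
apply: (measurableT_comp (@measurable_snoc _ (U * X)%type k)
  (g := fun q : traj k * (U * X) => (q.1.2, q.2))).
apply: measurable_fun_pair; last exact: measurable_snd.
exact: measurableT_comp measurable_snd measurable_fst.
Qed.

Lemma measurable_state k j : measurable_fun [set: traj k] (fun p => state p j).
Proof.
case: j => [|i]; first exact: measurable_fst.
have [ik|ki] := ltnP i k; last first.
  (* Beyond the length of the trajectory [nth] returns its default value, the initial state. *)
  rewrite (_ : (fun p => _) = fst); first exact: measurable_fst.
  by apply/funext => p; rewrite /state /= nth_default// size_map size_tuple.
rewrite (_ : (fun p => _) = snd \o (@tnth k (U * X) ^~ (Ordinal ik)) \o snd).
  apply: measurableT_comp; last exact: measurable_snd.
  by apply: measurableT_comp; [exact: measurable_snd|exact: measurable_tnth].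
apply/funext => -[x t]; rewrite /state /= (nth_map (tnth t (Ordinal ik))) ?size_tuple//.
by rewrite -(tnth_nth _ t (Ordinal ik)).
Qed.

Lemma state_snoc k (p : traj k) w i : (i <= k)%N ->
  state (traj_snoc (p, w)) i = state p i.
Proof.
move=> ik; case: p => x t; rewrite /state /= map_rcons -rcons_cons nth_rcons.
by rewrite /= size_map size_tuple ltnS ik.
Qed.

Lemma state_snoc_last k (p : traj k) w : state (traj_snoc (p, w)) k.+1 = w.2.
Proof.
case: p => x t; rewrite /state /= map_rcons nth_rcons size_map size_tuple.
by rewrite ltnn eqxx.
Qed.

Lemma integral_traj0 (F : traj 0 -> \bar R) :
  measurable_fun [set: traj 0] F -> (forall p, 0 <= F p) ->
  \int[muT 0]_p F p = \int[muX]_x F (x, [tuple]).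
Proof.
move=> mF F0; rewrite integral_sf_product//.
apply: eq_integral => x _; rewrite /= integral_dirac//.
  by rewrite diracT mul1e.
exact: (measurableT_comp mF (pair1_measurable x)).
Qed.

(** The power measure grows by a pushforward along [snoc] inside the second component of
    [X * k.-tuple (U * X)], whereas here the new pair is split off from the whole trajectory.
    Iterated integrals, through the inner integral [H], do the reassociation. *)
Lemma integral_trajS k (F : traj k.+1 -> \bar R) :
  measurable_fun [set: traj k.+1] F -> (forall p, 0 <= F p) ->
  \int[muT k.+1]_p F p =
  \int[sf_product (muT k) (sf_product muU muX)]_q F (traj_snoc q).
Proof.
move=> mF F0.
have mFs : measurable_fun [set: traj k * (U * X)] (F \o @traj_snoc k).
  by apply: measurableT_comp => //; exact: measurable_traj_snoc.
pose H (z : traj k) := \int[sf_product muU muX]_w F (traj_snoc (z, w)).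
have mH : measurable_fun [set: traj k] H.
  apply: (@measurable_integral_snd _ _ _ _ _ (sf_product muU muX)
    (F \o @traj_snoc k)) => // z.
  exact: F0.
have H0 z : 0 <= H z by apply: integral_ge0 => w _.
transitivity (\int[muX]_x \int[power_measure (sf_product muU muX) k.+1]_t F (x, t)).
  exact: integral_sf_product.
transitivity (\int[muT k]_z H z); last first.
  by apply/esym; apply: integral_sf_product => // z; exact: F0.
transitivity (\int[muX]_x \int[power_measure (sf_product muU muX) k]_t H (x, t)); last first.
  exact/esym/integral_sf_product.
apply: eq_integral => x _ /=.
rewrite ge0_integral_pushforward//.
- rewrite preimage_setT integral_sf_product//.
  have mx : measurable_fun [set: k.-tuple (U * X) * (U * X)]
      (fun z : k.-tuple (U * X) * (U * X) => ((x, z.1), z.2)).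
    apply: measurable_fun_pair; last exact: measurable_snd.
    exact: measurableT_comp (pair1_measurable x) measurable_fst.
  exact: measurableT_comp mFs mx.
- by move=> z; exact: F0.
- exact: measurable_snoc.
- exact: measurableT_comp mF (pair1_measurable x).
Qed.

(** * Joint densities and state marginals along trajectories *)

Section densities.
Variables (tX : nat -> X -> U * X -> R) (tU : nat -> U -> X -> R) (t0 : X -> R).

Definition step_pdf k (w : U * X) (y : X) : R := tX k w.2 (w.1, y) * tU k w.1 y.

(** Appending a pair alters neither the earlier pairs nor the states x_0, ..., x_k, so one factor is
    new. This Markov factorization underlies every recursion over trajectories. *)
Lemma joint_pdf_snoc k (p : traj k) w :
  joint_pdf tX tU t0 (traj_snoc (p, w)) =
  (joint_pdf tX tU t0 p * step_pdf k.+1 w (state p k))%R.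
Proof.
rewrite /joint_pdf big_ord_recr /= /step_pdf.
have -> : tnth (snoc (p.2, w)) ord_max = w.
  by rewrite (tnth_nth w) /= nth_rcons size_tuple ltnn eqxx.
rewrite (state_snoc p w (leqnn k)) mulrAC; congr (_ * _ * _)%R.
apply: eq_bigr => i _.
have -> : tnth (snoc (p.2, w)) (widen_ord (leqnSn k) i) = tnth p.2 i.
  by rewrite !(tnth_nth w) /= nth_rcons size_tuple ltn_ord.
by rewrite /= (state_snoc p w (ltnW (ltn_ord i))).
Qed.

Lemma is_cond_pdf_step k : is_cond_pdf muX (tX k) -> is_cond_pdf muU (tU k) ->
  is_cond_pdf (sf_product muU muX) (step_pdf k).
Proof.
move=> pX pU; split => [|y].
  have [mX _] := pX; have [mU _] := pU.
  apply: measurable_funM.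
    apply: (measurableT_comp mX (g := fun z : (U * X) * X => (z.1.2, (z.1.1, z.2)))).
    apply: measurable_fun_pair.
      exact: measurableT_comp measurable_snd measurable_fst.
    apply: measurable_fun_pair; last exact: measurable_snd.
    exact: measurableT_comp measurable_fst measurable_fst.
  apply: (measurableT_comp mU (g := fun z : (U * X) * X => (z.1.1, z.2))).
  apply: measurable_fun_pair; last exact: measurable_snd.
  exact: measurableT_comp measurable_fst measurable_fst.
(* Input first: given y, u follows the policy and then x the plant given (u, y). This is the order
   in which [is_pdf_mul_cond] reads a product. *)
rewrite (_ : (step_pdf k)^~ y = fun z => (tU k z.1 y * tX k z.2 (z.1, y))%R).
  apply: (@is_pdf_mul_cond _ _ _ _ _ muU muX (tU k ^~ y) (fun x u => tX k x (u, y))).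
    by case: pU.
  by apply: is_cond_pdf_comp pX; exact: pair2_measurable.
by apply/funext => w; rewrite /step_pdf mulrC.
Qed.

Lemma joint_pdf0 x : joint_pdf tX tU t0 ((x, [tuple]) : traj 0) = t0 x.
Proof. by rewrite /joint_pdf big_ord0 mul1r. Qed.

Section pdfs.
Variable n : nat.
Hypothesis pX : forall k, (0 < k <= n)%N -> is_cond_pdf muX (tX k).
Hypothesis pU : forall k, (0 < k <= n)%N -> is_cond_pdf muU (tU k).
Hypothesis p0 : is_pdf muX t0.

Lemma measurable_joint_pdf k : (k <= n)%N ->
  measurable_fun [set: traj k] (@joint_pdf _ _ _ _ _ tX tU t0 k).
Proof.
move=> kn; apply: measurable_funM; last first.
  by case: p0 => mp0 _ _; exact: measurableT_comp mp0 measurable_fst.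
apply: measurable_prod => i _.
have i1n : (0 < i.+1 <= n)%N by rewrite (leq_trans (ltn_ord i)).
have mt : measurable_fun [set: traj k] (fun p : traj k => tnth p.2 i).
  exact: measurableT_comp (@measurable_tnth _ (U * X)%type _ i) measurable_snd.
have mt1 := measurableT_comp measurable_fst mt.
have mt2 := measurableT_comp measurable_snd mt.
apply: measurable_funM.
  have [mX _] := pX i1n.
  apply: (measurableT_comp mX
    (g := fun p : traj k => ((tnth p.2 i).2, ((tnth p.2 i).1, state p i)))).
  apply: measurable_fun_pair => //; apply: measurable_fun_pair => //.
  exact: measurable_state.
have [mU _] := pU i1n.
apply: (measurableT_comp mU (g := fun p : traj k => ((tnth p.2 i).1, state p i))).
by apply: measurable_fun_pair => //; exact: measurable_state.
Qed.

Lemma is_cond_pdf_joint_step k : (k < n)%N ->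
  is_cond_pdf (sf_product muU muX) (fun w (p : traj k) => step_pdf k.+1 w (state p k)).
Proof.
move=> kn; apply: is_cond_pdf_comp; first exact: measurable_state.
by apply: is_cond_pdf_step; [exact: pX|exact: pU].
Qed.

Lemma is_pdf_joint k : (k <= n)%N -> is_pdf (muT k) (@joint_pdf _ _ _ _ _ tX tU t0 k).
Proof.
elim: k => [_|k ih kn].
  have mj := measurable_joint_pdf (leq0n n).
  have [_ t00 t01] := p0.
  have j0 (p : traj 0) : (0 <= joint_pdf tX tU t0 p)%R.
    by rewrite /joint_pdf big_ord0 mul1r.
  split => //; rewrite integral_traj0.
  - by rewrite -[RHS]t01; apply: eq_integral => x _; rewrite joint_pdf0.
  - exact/measurable_EFinP.
  - by move=> p; rewrite lee_fin.
have mj := measurable_joint_pdf kn.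
have [_ s0 s1] := is_pdf_mul_cond (ih (ltnW kn)) (is_cond_pdf_joint_step kn).
have j0 (p : traj k.+1) : (0 <= joint_pdf tX tU t0 p)%R.
  apply: mulr_ge0; last by case: p0.
  apply: prodr_ge0 => i _; have i1n : (0 < i.+1 <= n)%N by rewrite (leq_trans (ltn_ord i)).
  apply: mulr_ge0; first by have [_ /(_ ((tnth p.2 i).1, state p i))[]] := pX i1n.
  by have [_ /(_ (state p i))[]] := pU i1n.
split => //; rewrite integral_trajS.
- by rewrite -[RHS]s1; apply: eq_integral => -[p w] _; rewrite joint_pdf_snoc.
- exact/measurable_EFinP.
- by move=> p; rewrite lee_fin.
Qed.

Lemma integral_jointS k (h : traj k.+1 -> \bar R) : (k < n)%N ->
  measurable_fun [set: traj k.+1] h -> (forall p, 0 <= h p) ->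
  \int[muT k.+1]_p (h p * (joint_pdf tX tU t0 p)%:E) =
  \int[muT k]_p ((\int[sf_product muU muX]_w
    (h (traj_snoc (p, w)) * (step_pdf k.+1 w (state p k))%:E)) *
      (joint_pdf tX tU t0 p)%:E).
Proof.
move=> kn mh h0.
have [mj j0 _] := is_pdf_joint kn.
have [mj' j0' _] := is_pdf_joint (ltnW kn).
rewrite integral_trajS; last 2 first.
- by apply: emeasurable_funM => //; exact/measurable_EFinP.
- by move=> p; rewrite mule_ge0// lee_fin.
rewrite -(integral_mul_cond_pdf _ mj' j0' (is_cond_pdf_joint_step kn)
  (h := h \o @traj_snoc k)).
- by apply: eq_integral => -[p w] _; rewrite joint_pdf_snoc.
- by apply: measurableT_comp => //; exact: measurable_traj_snoc.
- by move=> z; exact: h0.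
Qed.

(** Tonelli integrates out all but the last state. The marginal is defined through [fine], which
    changes it on a null set at most: the extended-real marginal [s] has mass 1, hence is finite
    almost everywhere. *)
Lemma integral_state_pdf k (phi : X -> \bar R) : (k <= n)%N ->
  measurable_fun [set: X] phi -> (forall x, 0 <= phi x) ->
  measurable_fun [set: X] (state_pdf muX muU tX tU t0 k) /\
  \int[muT k]_p (phi (state p k) * (joint_pdf tX tU t0 p)%:E) =
  \int[muX]_x (phi x * (state_pdf muX muU tX tU t0 k x)%:E).
Proof.
case: k => [_ mphi phi0|k kn mphi phi0].
  have [mt0 t00 _] := p0; split => //.
  rewrite integral_traj0.
  - by apply: eq_integral => x _; rewrite joint_pdf0.
  - apply: emeasurable_funM.
      by apply: (measurableT_comp mphi); exact: measurable_state.
    by apply/measurable_EFinP; exact: measurable_joint_pdf.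
  - by move=> p; rewrite mule_ge0// lee_fin; case: (is_pdf_joint (leq0n n)).
have [mj j0 j1] := is_pdf_joint kn.
pose F (z : (traj k * U) * X) := joint_pdf tX tU t0 (traj_snoc (z.1.1, (z.1.2, z.2))).
have mF : measurable_fun [set: (traj k * U) * X] F.
  apply: (measurableT_comp mj).
  apply: (measurableT_comp (@measurable_traj_snoc k)
    (g := fun z : (traj k * U) * X => (z.1.1, (z.1.2, z.2)))).
  apply: measurable_fun_pair; first exact: measurableT_comp measurable_fst measurable_fst.
  apply: measurable_fun_pair; last exact: measurable_snd.
  exact: measurableT_comp measurable_snd measurable_fst.
have F0 z : 0 <= (F z)%:E by rewrite lee_fin; exact: j0.
have mEF : measurable_fun [set: (traj k * U) * X] (EFin \o F) by exact/measurable_EFinP.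
pose s x := \int[sf_product (muT k) muU]_q (F (q, x))%:E.
have ms : measurable_fun [set: X] s.
  exact: (@measurable_fun_fubini_tonelli_G _ _ _ _ _ (sf_product (muT k) muU) (EFin \o F) mEF F0).
have s0 x : 0 <= s x by apply: integral_ge0.
(* Needed for two functions: the constant 1, for the mass of [s], and [phi] itself. *)
have key (psi : X -> \bar R) : measurable_fun [set: X] psi -> (forall x, 0 <= psi x) ->
    \int[muT k.+1]_p (psi (state p k.+1) * (joint_pdf tX tU t0 p)%:E) =
    \int[muX]_x (psi x * s x).
  move=> mpsi psi0.
  pose G (z : (traj k * U) * X) := psi z.2 * (F z)%:E.
  have mG : measurable_fun [set: (traj k * U) * X] G.
    apply: emeasurable_funM => //; apply: (measurableT_comp mpsi).
    exact: measurable_snd.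
  have G0 z : 0 <= G z by rewrite mule_ge0.
  rewrite integral_trajS; last 2 first.
  - apply: emeasurable_funM; last exact/measurable_EFinP.
    by apply: (measurableT_comp mpsi); exact: measurable_state.
  - by move=> p; rewrite mule_ge0// lee_fin.
  transitivity (\int[muT k]_p \int[muU]_u \int[muX]_x G ((p, u), x)).
    rewrite integral_sf_product.
    + apply: eq_integral => p _; rewrite integral_sf_product.
      * apply: eq_integral => u _; apply: eq_integral => x _.
        by rewrite state_snoc_last.
      * apply: emeasurable_funM.
          under eq_fun do rewrite state_snoc_last.
          by apply: (measurableT_comp mpsi); exact: measurable_snd.
        apply/measurable_EFinP; apply: (measurableT_comp mj).
        apply: (measurableT_comp (@measurable_traj_snoc k)).
        exact: pair1_measurable.
      * by move=> z; rewrite mule_ge0// lee_fin.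
    + apply: emeasurable_funM.
        apply: (measurableT_comp mpsi).
        apply: (measurableT_comp (@measurable_state k.+1 k.+1)).
        exact: measurable_traj_snoc.
      apply/measurable_EFinP; apply: (measurableT_comp mj).
      exact: measurable_traj_snoc.
    + by move=> z; rewrite mule_ge0// lee_fin.
  (* Grouped as ((trajectory, input), state), the last state is the second factor and can be
     exchanged with all the rest. *)
  transitivity (\int[sf_product (muT k) muU]_q \int[muX]_x G (q, x)).
    apply/esym; apply: (integral_sf_product _ _ (f := fun q => \int[muX]_x G (q, x))).
    - exact: measurable_integral_snd.
    - by move=> q; exact: integral_ge0.
  rewrite (fubini_tonelli G)//; apply: eq_integral => x _.
  rewrite /G /= ge0_integralZl//.
  exact: (measurableT_comp mEF (pair2_measurable x)).
have sE x : state_pdf muX muU tX tU t0 k.+1 x = fine (s x) by [].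
split; first exact: measurableT_comp ms.
rewrite key//; apply: ge0_ae_eq_integral => //.
- exact: emeasurable_funM.
- apply: emeasurable_funM => //; apply/measurable_EFinP.
  exact: measurableT_comp ms.
- by move=> x _; rewrite mule_ge0.
- by move=> x _; rewrite mule_ge0// sE lee_fin fine_ge0.
have : muX.-integrable [set: X] s.
  apply/integrableP; split => //.
  have := key (cst 1) (measurable_cst _) (fun=> lee01).
  under eq_integral do rewrite mul1e.
  rewrite j1; under eq_integral do rewrite mul1e.
  by under [in X in _ -> X]eq_integral do rewrite gee0_abs//; move=> <-; rewrite ltry.
move=> /(integrable_ae measurableT); apply: filterS => x h _.
by rewrite sE fineK// h.
Qed.

End pdfs.

End densities.

Lemma KL_jointS (fX gX : nat -> X -> U * X -> R) (fU gU : nat -> U -> X -> R)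
    (f0 g0 : X -> R) n k :
  (forall k, (0 < k <= n)%N -> is_cond_pdf muX (fX k)) ->
  (forall k, (0 < k <= n)%N -> is_cond_pdf muU (fU k)) ->
  is_pdf muX f0 ->
  (forall k, (0 < k <= n)%N -> is_cond_pdf muX (gX k)) ->
  (forall k, (0 < k <= n)%N -> is_cond_pdf muU (gU k)) ->
  is_pdf muX g0 -> (k < n)%N ->
  KL (muT k.+1) (joint_pdf fX fU f0 (k := k.+1)) (joint_pdf gX gU g0 (k := k.+1)) =
  KL (muT k) (joint_pdf fX fU f0 (k := k)) (joint_pdf gX gU g0 (k := k)) +
  \int[muT k]_p (KL (sf_product muU muX) (step_pdf fX fU k.+1 ^~ (state p k))
     (step_pdf gX gU k.+1 ^~ (state p k)) * (joint_pdf fX fU f0 p)%:E).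
Proof.
move=> pfX pfU pf0 pgX pgU pg0 kn.
have pf := is_pdf_joint pfX pfU pf0 (ltnW kn).
have pg := is_pdf_joint pgX pgU pg0 (ltnW kn).
have sf := is_cond_pdf_joint_step pfX pfU kn.
have sg := is_cond_pdf_joint_step pgX pgU kn.
have pf1 := is_pdf_joint pfX pfU pf0 kn.
have pg1 := is_pdf_joint pgX pgU pg0 kn.
rewrite -(KL_chain pf pg sf sg) KLE//.
rewrite integral_trajS; last 2 first.
- by case: pf1 pg1 => mf _ _ [mg _ _]; exact: (measurable_kl_integrand mf mg).
- by case: pf1 pg1 => _ f0' _ [_ g0' _] p; exact: kl_integrand_ge0.
rewrite (KLE (is_pdf_mul_cond pf sf) (is_pdf_mul_cond pg sg)).
by apply: eq_integral => -[p w] _; rewrite !joint_pdf_snoc.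
Qed.

End traj.

(** * Exponential tilts: measurability and pointwise effect on the divergence *)

Section more_real_lemmas.
Context {R : realType}.

Lemma measurable_expeR : measurable_fun [set: \bar R] (@expeR R).
Proof.
rewrite (_ : @expeR R = fun x =>
    if x == +oo%E then +oo%E else if x == -oo%E then 0%E else (expR (fine x))%:E).
  apply: measurable_fun_ifT; [exact: measurable_fun_eqe|exact: measurable_cst|].
  apply: measurable_fun_ifT; [exact: measurable_fun_eqe|exact: measurable_cst|].
  by apply/measurable_EFinP; apply: measurableT_comp => //; exact: fine_measurable.
by apply/funext => -[r||].
Qed.

Lemma measurable_fun_mem_if d (T : measurableType d) (D : set T) (f : T -> R) :
  measurable D -> measurable_fun D f ->
  measurable_fun [set: T] (fun x => if x \in D then f x else 0).
Proof.
move=> mD mf; apply: measurable_fun_if => //.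
- apply: (@measurable_fun_bool _ _ _ _ true).
  rewrite setTI (_ : _ @^-1` _ = D)//.
  by apply/seteqP; split => x; [exact: set_mem|exact: mem_set].
- rewrite setTI (_ : _ @^-1` _ = D)//.
  by apply/seteqP; split => x; [exact: set_mem|exact: mem_set].
Qed.

Lemma measurable_dotv d (T : measurableType d) (D : set T) m (v w : T -> 'cV[R]_m) :
  (forall i, measurable_fun D (fun x => v x i 0%R)) ->
  (forall i, measurable_fun D (fun x => w x i 0%R)) ->
  measurable_fun D (fun x => dotv (v x) (w x)).
Proof.
by move=> mv mw; apply: measurable_sum => i; exact: measurable_funM.
Qed.

Local Open Scope ereal_scope.

(** The stage identity before integration, with w for [omega_hat], c for <lam, h> and l for 1 +
    lam0. For positive finite data it amounts to ln(p/f) = ln(p/g) + w + c + l; g and f are added to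
    absorb the shifts, and the signed multiplier term stands apart from the nonnegative ones. *)
Lemma kl_integrand_tilt (p g c l : R) (w : \bar R) :
  (0 <= p)%R -> (0 <= g)%R -> 0 <= w ->
  let f := (g * (fine (expeR (- (w + c%:E))) / expR l))%R in
  kl_integrand p f + g%:E =
  kl_integrand p g + (w * p%:E + f%:E) + (p * (c + l))%:E.
Proof.
move=> p0 g0 w0 f; rewrite /kl_integrand.
have [->|pn0] := eqVneq p 0%R.
  by rewrite /= mule0 add0e mul0r adde0 addeC.
have {pn0}p0' : (0 < p)%R by rewrite lt_neqAle eq_sym pn0.
(* If g = 0, and likewise below if w is [+oo], then f = 0 < p and both sides are [+oo]. *)
have [g_0|gn0] := eqVneq g 0%R.
  have f0 : f = 0%R by rewrite /f g_0 mul0r.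
  have wp : w * p%:E + 0%:E != -oo.
    by rewrite adde0; apply: contraTneq (mule_ge0 w0 (p0 : 0 <= p%:E)) => ->.
  by rewrite f0 g_0 !eqxx !addye.
case: w w0 @f => [w w0 f|_ f|//]; last first.
  have f0 : f = 0%R by rewrite /f /= mul0r mulr0.
  by rewrite f0 eqxx gt0_mulye ?lte_fin// addye// addey// addye.
have {gn0}g0' : (0 < g)%R by rewrite lt_neqAle eq_sym gn0.
have fE : f = (g * (expR (- (w + c)) / expR l))%R by [].
have fp : (0 < f)%R by rewrite fE mulr_gt0// divr_gt0// expR_gt0.
rewrite gt_eqF// -EFinM -!EFinD; congr (_%:E).
have -> : ln (p / f) = (ln (p / g) + (w + c + l))%R.
  rewrite fE !ln_div ?posrE ?mulr_gt0 ?divr_gt0 ?invr_gt0 ?expR_gt0//.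
  rewrite lnM ?posrE ?divr_gt0 ?invr_gt0 ?expR_gt0// ln_div ?posrE ?expR_gt0// !expRK.
  by ring.
by ring.
Qed.

End more_real_lemmas.

(** * One stage *)

Section stage.
Context d1 d2 (X : measurableType d1) (U : measurableType d2) (R : realType).
Context (muX : {sigma_finite_measure set X -> \bar R})
  (muU : {sigma_finite_measure set U -> \bar R}).
Variable P : control_problem muX muU.
Variables (lam0 : nat -> X -> R) (lam : forall k, X -> 'cV[R]_(nc P k)).
Hypothesis lamP : are_multipliers lam0 lam.
Local Notation n := (horizon P).
Local Notation fs := (f_star lam0 lam).
Local Open Scope ereal_scope.

(* The optimal cost to go from x_j. *)
Definition value j (x : X) : R := - ln (gamma_hat lam0 lam j x).

Lemma value_lt j x : (j < n)%N ->
  value j x = (- (lam0 j.+1 x + 1 + dotv (lam j.+1 x) (H_u P j.+1)))%R.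
Proof.
move=> jn; rewrite /value /gamma_hat jn expRK /gamma_u0 expRK; congr (- (_ + _))%R.
by apply: eq_bigr => i _; rewrite /gamma_u expRK.
Qed.

Lemma value_pred k x : (0 < k <= n)%N ->
  value k.-1 x = (- (lam0 k x + 1 + dotv (lam k x) (H_u P k)))%R.
Proof. by case: k => // k kn; exact: value_lt. Qed.

Lemma value_horizon x : value n x = 0%R.
Proof. by rewrite /value /gamma_hat ltnn ln1 oppr0. Qed.

Lemma measurable_value j : (j <= n)%N -> measurable_fun [set: X] (value j).
Proof.
rewrite leq_eqVlt => /predU1P[->|jn].
  by rewrite (_ : value n = cst 0%R)//; apply/funext => x; exact: value_horizon.
have [ml0 ml _] := lamP (jn : (0 < j.+1 <= n)%N).
rewrite (_ : value j =
    fun x => - (lam0 j.+1 x + 1 + dotv (lam j.+1 x) (H_u P j.+1)))%R; last first.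
  by apply/funext => x; exact: value_lt.
apply: measurableT_comp => //; apply: measurable_funD; first exact: measurable_funD.
by apply: measurable_dotv => // i; exact: measurable_cst.
Qed.

Section policy.
Variables (k : nat) (pi : U -> X -> R).
Hypothesis kn : (0 < k <= n)%N.
Hypothesis pi_feasible : feasible_at P k pi.

Lemma feasible_at_out u y : u \notin U_dom P k -> pi u y = 0%R.
Proof.
case: pi_feasible => _ _ sup _; apply: contraNeq => piu.
by apply/mem_set/(sup y).
Qed.

(** Component 0 of the constraints: the indicator is 1 on the support of [pi], so this component is
    the normalization. *)
Lemma feasible_at_cond_pdf : is_cond_pdf muU pi.
Proof.
case: (pi_feasible) => mpi pi0 sup cons; split => // y; split => //.
  exact: measurableT_comp mpi (pair2_measurable y).
have := cons y (lshift _ ord0); rewrite pdf_expectationE /H_tilde col_mxEu mxE eqxx mulr1n.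
move=> <-; apply: eq_integral => u _; rewrite /h_tilde col_mxEu mxE eqxx mulr1n indicE.
have [uU|uU] := boolP (u \in U_dom P k); first by rewrite mul1e.
by rewrite (feasible_at_out _ uU) mule0.
Qed.

Lemma feasible_at_moment y i :
  \int[muU]_u (pi u y * h_u P k u i 0)%:E = (H_u P k i 0)%:E.
Proof.
case: (pi_feasible) => _ _ _ cons.
have := cons y (rshift _ i); rewrite pdf_expectationE /H_tilde col_mxEd => <-.
by apply: eq_integral => u _; rewrite /h_tilde col_mxEd -EFinM mulrC.
Qed.

(** Integrability is read off from the constraint: an integral is the difference of the integrals of
    the positive and negative parts, and it is a finite number only if both are finite. *)
Lemma integrable_moment y i :
  muU.-integrable [set: U] (EFin \o (fun u => pi u y * h_u P k u i 0)%R).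
Proof.
have [_ /(_ y)[mpi _ _]] := feasible_at_cond_pdf.
have mphi : measurable_fun [set: U] (fun u => pi u y * h_u P k u i 0)%R.
  (* [h_u] is known to be measurable on [U_dom P k] only; outside it [pi] is 0. *)
  rewrite (_ : (fun u => _) =
      fun u => if u \in U_dom P k then (pi u y * h_u P k u i 0)%R else 0%R).
    apply: measurable_fun_mem_if; first exact: U_dom_measurable.
    by apply: measurable_funM; [exact: measurable_funTS|exact: h_u_measurable].
  apply/funext => u; case: ifPn => // uU.
  by rewrite (feasible_at_out _ uU) mul0r.
apply/integrableP; split; first exact/measurable_EFinP.
by rewrite integral_fin_num_abs// feasible_at_moment.
Qed.

(** Linearity applied to the constraints. For the multipliers of time k and c = 1 + lam0 the value
    is - V_(k-1), which is how [gamma_hat] enters. *)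
Lemma integral_multipliers y (c : R) (l : 'cV[R]_(nc P k)) :
  muU.-integrable [set: U] (EFin \o (fun u => pi u y * (dotv l (h_u P k u) + c))%R) /\
  \int[muU]_u (EFin \o (fun u => pi u y * (dotv l (h_u P k u) + c))%R) u =
  (dotv l (H_u P k) + c)%:E.
Proof.
have [_ /(_ y)[mpi pi0 pi1]] := feasible_at_cond_pdf.
have ipi : muU.-integrable [set: U] (EFin \o (pi ^~ y)).
  apply/integrableP; split; first exact/measurable_EFinP.
  by rewrite integral_fin_num_abs// pi1.
have ih i : muU.-integrable [set: U]
    (fun u => (l i 0%R)%:E * (EFin \o (fun u => pi u y * h_u P k u i 0)%R) u).
  by apply: integrableZl => //; exact: integrable_moment.
have isum := @integrable_sum _ _ _ muU _ measurableT _ (index_enum _) xpredT _ (fun i _ => ih i).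
have ic : muU.-integrable [set: U] (fun u => c%:E * (EFin \o (pi ^~ y)) u).
  exact: integrableZl.
have -> : EFin \o (fun u => pi u y * (dotv l (h_u P k u) + c))%R =
    (fun u => (\sum_(i < nc P k) ((l i 0%R)%:E *
      (EFin \o (fun u => pi u y * h_u P k u i 0)%R) u)) + c%:E * (EFin \o (pi ^~ y)) u).
  apply/funext => u /=.
  under eq_bigr do rewrite -EFinM.
  rewrite sumEFin -EFinM -EFinD; congr (_%:E).
  rewrite mulrDr (mulrC c); congr (_ + _)%R.
  by rewrite /dotv mulr_sumr; apply: eq_bigr => i _; rewrite mulrCA.
split; first exact: integrableD.
rewrite integralD//=.
rewrite integral_sum// integralZl//= pi1 mule1 EFinD -sumEFin; congr (_ + _).
by apply: eq_bigr => i _; rewrite integralZl ?integrable_moment//= feasible_at_moment EFinM.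
Qed.

End policy.

(** * The backward step from V_k to V_(k-1) *)

Section step.
Variable k : nat.
Hypothesis kn : (0 < k <= n)%N.
Hypothesis value_ge0 : forall x, (0 <= value k x)%R.

Let pX := f_X_pdf (c := P) kn.
Let pgX := g_X_pdf (c := P) kn.
Let pgU := g_U_pdf (c := P) kn.

(** The sign can be taken inside the integral because V_k has constant sign; the extended-real
    integral is not odd when both parts are infinite. *)
Lemma beta_hatE w : beta_hat lam0 lam k w =
  \int[muX]_x ((value k x)%:E * (f_X P k x w)%:E).
Proof.
have [_ /(_ w)[_ f0 _]] := pX.
rewrite /beta_hat pdf_expectationE.
rewrite (eq_integral (fun x => - ((value k x)%:E * (f_X P k x w)%:E))).
  by rewrite integral_ge0N ?oppeK// => x _; rewrite mule_ge0// lee_fin.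
by move=> x _; rewrite /value EFinN mulNe oppeK.
Qed.

Lemma beta_hat_ge0 w : 0 <= beta_hat lam0 lam k w.
Proof.
have [_ /(_ w)[_ f0 _]] := pX.
by rewrite beta_hatE; apply: integral_ge0 => x _; rewrite mule_ge0// lee_fin.
Qed.

Lemma measurable_beta_hat : measurable_fun [set: U * X] (beta_hat lam0 lam k).
Proof.
have mX := measurable_cond_pdf pX.
rewrite (_ : beta_hat lam0 lam k = fun w => \int[muX]_x
    (fun z : (U * X) * X => (value k z.2)%:E * (f_X P k z.2 z.1)%:E) (w, x)).
  apply: (@measurable_integral_snd _ _ _ _ _ muX
    (fun z : (U * X) * X => (value k z.2)%:E * (f_X P k z.2 z.1)%:E)).
    apply: emeasurable_funM; apply/measurable_EFinP => //.
    case/andP: (kn) => _ kn'.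
    exact: measurableT_comp (measurable_value kn') measurable_snd.
  move=> z; rewrite mule_ge0// lee_fin//.
  by have [_ /(_ z.1)[]] := pX.
by apply/funext => w; exact: beta_hatE.
Qed.

Lemma alpha_hat_ge0 w : 0 <= alpha_hat P k w.
Proof. by apply: KL_ge0; [case: pX|case: pgX]. Qed.

Lemma measurable_alpha_hat : measurable_fun [set: U * X] (alpha_hat P k).
Proof. exact: measurable_KL_cond. Qed.

Lemma omega_hat_ge0 w : 0 <= omega_hat lam0 lam k w.
Proof. by rewrite adde_ge0 ?alpha_hat_ge0 ?beta_hat_ge0. Qed.

Lemma measurable_omega_hat : measurable_fun [set: U * X] (omega_hat lam0 lam k).
Proof.
by apply: emeasurable_funD; [exact: measurable_alpha_hat|exact: measurable_beta_hat].
Qed.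

Lemma f_star_ge0 u y : (0 <= fs k u y)%R.
Proof.
rewrite /f_star; case: ifP => // _.
apply: mulr_ge0; first by have [_ /(_ y)[]] := pgU.
by rewrite divr_ge0 ?expR_ge0// fine_ge0// expeR_ge0.
Qed.

(** [are_multipliers] supplies the constraints; the work lies in joint measurability, again with
    [h_u] restricted to [U_dom P k]. *)
Lemma f_star_feasible : feasible_at P k (fs k).
Proof.
have [ml0 ml cons] := lamP kn.
split => //; last 2 first.
- exact: f_star_ge0.
- move=> y u; rewrite /pdf_support /= /f_star; case: ifPn; first by rewrite inE.
  by rewrite eqxx.
have mD : measurable (U_dom P k `*` [set: X]).
  by apply: measurableX => //; exact: U_dom_measurable.
pose F (p : U * X) := (g_U P k p.1 p.2 *
  (fine (tilt lam0 lam k p.1 p.2) / expR (1 + lam0 k p.2)))%R.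
rewrite (_ : (fun p => _) =
    fun p : U * X => if p \in U_dom P k `*` [set: X] then F p else 0%R).
  apply: measurable_fun_mem_if => //.
  apply: measurable_funM; first by apply: measurable_funTS; case: pgU.
  apply: measurable_funM.
    apply: measurableT_comp; first exact: fine_measurable.
    apply: (measurableT_comp measurable_expeR).
    apply: measurableT_comp => //; apply: emeasurable_funD.
      rewrite (_ : (fun p => _) = omega_hat lam0 lam k); last by apply/funext => -[].
      by apply: measurable_funTS; exact: measurable_omega_hat.
    apply/measurable_EFinP; apply: measurable_dotv => i.
      by apply: measurable_funTS; exact: (measurableT_comp (ml i) measurable_snd).
    apply: (measurable_comp (F := U_dom P k) _ _ (h_u_measurable kn i)).
    - exact: U_dom_measurable.
    - by move=> u [[u' y] [/= + _] <-].
    - by apply: measurable_funTS; exact: measurable_fst.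
  apply: measurable_funTS; apply: (measurableT_comp (@measurable_invr R)).
  apply: measurableT_comp => //; apply: measurable_funD => //.
  exact: (measurableT_comp ml0 measurable_snd).
apply/funext => -[u y]; rewrite /f_star /=.
rewrite (_ : ((u, y) \in _) = (u \in U_dom P k))//.
by apply/idP/idP => [/set_mem[/mem_set]//|/set_mem uU]; exact: mem_set.
Qed.

(** Integrate [kl_integrand_tilt] over u: the masses of [f_star] and [g_U] cancel, and the
    multiplier term contributes - V_(k-1) by [integral_multipliers]. *)
Lemma KL_f_star pi y : feasible_at P k pi ->
  KL muU (pi ^~ y) (fs k ^~ y) + (value k.-1 y)%:E =
  KL muU (pi ^~ y) (g_U P k ^~ y) +
  \int[muU]_u (omega_hat lam0 lam k (u, y) * (pi u y)%:E).
Proof.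
move=> fpi.
have [_ /(_ y)ppi] := feasible_at_cond_pdf fpi.
have [_ /(_ y)pfs] := feasible_at_cond_pdf f_star_feasible.
have [_ /(_ y)pg] := pgU.
have [mpi pi0 pi1] := ppi; have [mfs fs0 fs1] := pfs; have [mg g0 g1] := pg.
rewrite !KLE//.
have mkf := measurable_kl_integrand mpi mfs.
have mkg := measurable_kl_integrand mpi mg.
have kf0 u : 0 <= kl_integrand (pi u y) (fs k u y) by exact: kl_integrand_ge0.
have kg0 u : 0 <= kl_integrand (pi u y) (g_U P k u y) by exact: kl_integrand_ge0.
have mo : measurable_fun [set: U] (fun u => omega_hat lam0 lam k (u, y) * (pi u y)%:E).
  apply: emeasurable_funM; last exact/measurable_EFinP.
  exact: (measurableT_comp measurable_omega_hat (pair2_measurable y)).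
have o0 u : 0 <= omega_hat lam0 lam k (u, y) * (pi u y)%:E.
  by rewrite mule_ge0 ?omega_hat_ge0// lee_fin.
have mEfs : measurable_fun [set: U] (fun u => (fs k u y)%:E) by exact/measurable_EFinP.
have mEg : measurable_fun [set: U] (fun u => (g_U P k u y)%:E) by exact/measurable_EFinP.
have [iphi phiE] := integral_multipliers kn fpi y (1 + lam0 k y) (lam k y).
have := @integral_adde_real _ U R muU
  (fun u => kl_integrand (pi u y) (fs k u y) + (g_U P k u y)%:E)
  (fun u => kl_integrand (pi u y) (g_U P k u y) +
     (omega_hat lam0 lam k (u, y) * (pi u y)%:E + (fs k u y)%:E))
  (fun u => pi u y * (dotv (lam k y) (h_u P k u) + (1 + lam0 k y)))%R.
rewrite phiE ge0_integralD//; last by move=> u _; rewrite lee_fin.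
rewrite ge0_integralD//; last 2 first.
- by move=> u _; rewrite adde_ge0// lee_fin.
- exact: emeasurable_funD.
rewrite ge0_integralD//; last by move=> u _; rewrite lee_fin.
rewrite g1 fs1 => key.
rewrite value_pred//.
have -> : (- (lam0 k y + 1 + dotv (lam k y) (H_u P k)))%:E =
    - (dotv (lam k y) (H_u P k) + (1 + lam0 k y))%:E.
  by rewrite -EFinN; congr (_%:E); ring.
rewrite -[LHS](addeK _ (_ : 1 \is a fin_num))// (addeAC _ _ 1) key.
- by rewrite addeK// addeA addeK.
- by apply: emeasurable_funD.
- by apply: emeasurable_funD => //; exact: emeasurable_funD.
- by apply/measurable_EFinP; case/integrableP: iphi.
- by move=> u; rewrite adde_ge0// lee_fin.
- by move=> u; rewrite !adde_ge0// lee_fin.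
- have /integrableP[_ /(le_lt_trans _)->//] := integrable_funeneg measurableT iphi.
  by under [leRHS]eq_integral do rewrite gee0_abs//.
(* Outside [U_dom P k] the tilt formula does not describe [f_star], but there [pi] and [f_star] both
   vanish and the identity reads g = g. *)
apply: aeW => u; rewrite /f_star.
have [uU|uU] := boolP (u \in U_dom P k).
  exact: kl_integrand_tilt (omega_hat_ge0 _).
by rewrite (feasible_at_out fpi _ uU) mule0 mul0r /kl_integrand eqxx !adde0 add0e.
Qed.

Lemma value_pred_ge0 y : (0 <= value k.-1 y)%R.
Proof.
have [_ /(_ y)pfs] := feasible_at_cond_pdf f_star_feasible.
have [_ /(_ y)pg] := pgU.
have := KL_f_star y f_star_feasible.
rewrite KLxx// add0e -lee_fin => ->; rewrite adde_ge0 ?KL_ge0//.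
apply: integral_ge0 => u _; rewrite mule_ge0 ?omega_hat_ge0// lee_fin.
exact: f_star_ge0.
Qed.

End step.

Lemma value_ge0 j x : (j <= n)%N -> (0 <= value j x)%R.
Proof.
move=> jn; rewrite -(subKn jn); move: (n - j)%N (leq_subr j n) x => m.
elim: m => [_ x|m ih mn x]; first by rewrite subn0 value_horizon.
rewrite subnS; apply: value_pred_ge0 => [|x']; last exact: ih (ltnW mn) x'.
by rewrite subn_gt0 mn leq_subr.
Qed.

(** The normalization of [f_star], solved for lam0. As [omega_hat] is nonnegative the tilt is
    finite, so [fine] in [f_star] loses nothing; the integral is a positive number and [lne] is an
    ordinary logarithm. *)
Lemma lam0E k y : (0 < k <= n)%N ->
  (lam0 k y)%:E = lne (\int[muU]_(u in U_dom P k)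
    ((g_U P k u y)%:E * tilt lam0 lam k u y)) - 1.
Proof.
move=> kn.
have V0 x : (0 <= value k x)%R by apply: value_ge0; case/andP: kn.
have [_ g0 _] : is_pdf muU (g_U P k ^~ y) by case: (g_U_pdf (c := P) kn).
have fin u : tilt lam0 lam k u y = (fine (tilt lam0 lam k u y))%:E.
  rewrite fineK// ge0_fin_numE ?expeR_ge0//.
  rewrite ltey expeR_eqy; have := omega_hat_ge0 kn V0 (u, y).
  by case: (omega_hat _ _ _ _).
have [_ /(_ y)[mf f0 f1]] := feasible_at_cond_pdf (f_star_feasible kn V0).
have e : \int[muU]_(u in U_dom P k) ((g_U P k u y)%:E * tilt lam0 lam k u y) =
    (expR (1 + lam0 k y))%:E.
  have mf' : measurable_fun [set: U] (EFin \o (fs k ^~ y)) by exact/measurable_EFinP.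
  rewrite -[RHS]mule1 -f1 -(ge0_integralZl _ measurableT mf') => [|u _|]; last 2 first.
  - by rewrite lee_fin.
  - by rewrite lee_fin expR_ge0.
  rewrite [LHS]integral_mkcond; apply: eq_integral => u _.
  rewrite patchE /= /f_star; case: ifP => _; last by rewrite mule0.
  rewrite fin -!EFinM; congr (_%:E).
  by rewrite mulrCA (mulrC (expR _)) divfK// gt_eqF// expR_gt0.
by rewrite e lne_EFin ?expR_gt0// expRK -EFinB addrC addKr.
Qed.

End stage.

(** * All stages *)

Lemma eq_joint_pdf d1 d2 (X : measurableType d1) (U : measurableType d2) (R : realType)
    (tX : nat -> X -> U * X -> R) (tU tU' : nat -> U -> X -> R) (t0 : X -> R) k
    (p : X * k.-tuple (U * X)) :
  (forall i, (i < k)%N -> tU i.+1 = tU' i.+1) ->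
  joint_pdf tX tU t0 p = joint_pdf tX tU' t0 p.
Proof. by move=> e; congr (_ * _); apply: eq_bigr => i _; rewrite e. Qed.

Section multistage.
Context d1 d2 (X : measurableType d1) (U : measurableType d2) (R : realType).
Context (muX : {sigma_finite_measure set X -> \bar R})
  (muU : {sigma_finite_measure set U -> \bar R}).
Variable P : control_problem muX muU.
Variables (lam0 : nat -> X -> R) (lam : forall k, X -> 'cV[R]_(nc P k)).
Hypothesis lamP : are_multipliers lam0 lam.
Local Notation n := (horizon P).
Local Notation fs := (f_star lam0 lam).
Local Notation V := (value lam0 lam).
Local Notation muT := (traj_measure muX muU).
Local Open Scope ereal_scope.

(** By [KL_chain] with the input as first variable, the stage divergence is KL(pi || g_U) plus the
    mean of [alpha_hat]; the mean of V_k is that of [beta_hat]. The two means add up to that of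
    [omega_hat], and [KL_f_star] applies. *)
Lemma stage_identity k pi y : (0 < k <= n)%N -> feasible_at P k pi ->
  KL (sf_product muU muX) (fun w => f_X P k w.2 (w.1, y) * pi w.1 y)%R
                          (fun w => g_X P k w.2 (w.1, y) * g_U P k w.1 y)%R +
  \int[sf_product muU muX]_w
    ((V k w.2)%:E * (f_X P k w.2 (w.1, y) * pi w.1 y)%:E) =
  KL muU (pi ^~ y) (fs k ^~ y) + (V k.-1 y)%:E.
Proof.
move=> kn fpi; have kn' : (k <= n)%N by case/andP: kn.
have V0 x : (0 <= V k x)%R by exact: value_ge0.
rewrite (KL_f_star lamP kn V0 y fpi).
have [_ /(_ y)ppi] := feasible_at_cond_pdf fpi; have [mpi pi0 _] := ppi.
have [_ /(_ y)pg] := g_U_pdf (c := P) kn.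
have pfX : is_cond_pdf muX (fun x u => f_X P k x (u, y)).
  by apply: is_cond_pdf_comp (f_X_pdf kn); exact: pair2_measurable.
have pgX : is_cond_pdf muX (fun x u => g_X P k x (u, y)).
  by apply: is_cond_pdf_comp (g_X_pdf kn); exact: pair2_measurable.
have -> : (fun w => f_X P k w.2 (w.1, y) * pi w.1 y)%R =
    (fun w => pi w.1 y * f_X P k w.2 (w.1, y))%R.
  by apply/funext => w; rewrite mulrC.
have -> : (fun w => g_X P k w.2 (w.1, y) * g_U P k w.1 y)%R =
    (fun w => g_U P k w.1 y * g_X P k w.2 (w.1, y))%R.
  by apply/funext => w; rewrite mulrC.
have -> := KL_chain ppi pg pfX pgX.
under [X in _ + X = _]eq_integral do rewrite mulrC.
rewrite (integral_mul_cond_pdf muU mpi pi0 pfX (h := fun z => (V k z.2)%:E)); last 2 first.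
- by apply/measurable_EFinP; exact: measurableT_comp (measurable_value lamP kn') measurable_snd.
- by move=> z; rewrite lee_fin.
rewrite -addeA; congr (_ + _).
have a0 u : 0 <= alpha_hat P k (u, y) by exact: alpha_hat_ge0.
have b0 u : 0 <= beta_hat lam0 lam k (u, y) by exact: beta_hat_ge0.
have mpair := pair2_measurable (T1 := U) y.
have mEpi : measurable_fun [set: U] (EFin \o (pi ^~ y)) by exact/measurable_EFinP.
have ma : measurable_fun [set: U] (fun u => alpha_hat P k (u, y) * (pi u y)%:E).
  by apply: emeasurable_funM => //; exact: measurableT_comp (measurable_alpha_hat kn) mpair.
have mb : measurable_fun [set: U] (fun u => beta_hat lam0 lam k (u, y) * (pi u y)%:E).
  apply: emeasurable_funM => //.
  exact: measurableT_comp (measurable_beta_hat lamP kn V0) mpair.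
rewrite [X in _ + X = _](eq_integral
  (fun u => beta_hat lam0 lam k (u, y) * (pi u y)%:E)); last first.
  by move=> u _; rewrite beta_hatE.
transitivity (\int[muU]_u (alpha_hat P k (u, y) * (pi u y)%:E +
    beta_hat lam0 lam k (u, y) * (pi u y)%:E)).
  by rewrite ge0_integralD// => u _; rewrite mule_ge0// lee_fin.
by apply: eq_integral => u _; rewrite -ge0_muleDl.
Qed.

Definition expected_value k (fU : nat -> U -> X -> R) : \bar R :=
  \int[muT k]_p ((V k (state p k))%:E * (f_joint P fU p)%:E).

(** Index shift: the average is over x_k, while [pi] competes with the optimal policy of time
    [k.+1]. *)
Definition regret k (fU : nat -> U -> X -> R) (pi : U -> X -> R) : \bar R :=
  \int[muT k]_p (KL muU (pi ^~ (state p k)) (fs k.+1 ^~ (state p k)) *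
    (f_joint P fU p)%:E).

Section policies.
Variables (k : nat) (fU : nat -> U -> X -> R).
Hypothesis kn : (k <= n)%N.
Hypothesis fUP : forall j, (0 < j <= k)%N -> feasible_at P j (fU j).

Lemma le_horizon j : (0 < j <= k)%N -> (0 < j <= n)%N.
Proof. by move=> /andP[-> jk]; exact: leq_trans kn. Qed.

Lemma f_joint_plant_pdf j : (0 < j <= k)%N -> is_cond_pdf muX (f_X P j).
Proof. by move=> /le_horizon; exact: f_X_pdf. Qed.

Lemma f_joint_policy_pdf j : (0 < j <= k)%N -> is_cond_pdf muU (fU j).
Proof. by move=> /fUP; exact: feasible_at_cond_pdf. Qed.

Lemma f_joint_pdf : is_pdf (muT k) (f_joint P fU (k := k)).
Proof.
rewrite /f_joint.
exact: (is_pdf_joint f_joint_plant_pdf f_joint_policy_pdf (f_0_pdf P) (leqnn k)).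
Qed.

Lemma p_X_ge0 x : (0 <= p_X P fU k x)%R.
Proof.
rewrite /p_X; case: (k) f_joint_pdf => [_|j [_ f0 _]].
  by have [_ f0 _] := f_0_pdf P; exact: f0.
by apply: fine_ge0; apply: integral_ge0 => q _; rewrite lee_fin; exact: f0.
Qed.

Lemma integral_p_X (phi : X -> \bar R) :
  measurable_fun [set: X] phi -> (forall x, 0 <= phi x) ->
  measurable_fun [set: X] (p_X P fU k) /\
  \int[muT k]_p (phi (state p k) * (f_joint P fU p)%:E) =
  \int[muX]_x (phi x * (p_X P fU k x)%:E).
Proof.
exact: (integral_state_pdf f_joint_plant_pdf f_joint_policy_pdf (f_0_pdf P) (leqnn k)).
Qed.

Lemma expected_valueE :
  expected_value k fU =
  - pdf_expectation muX (p_X P fU k) (fun y => (ln (gamma_hat lam0 lam k y))%:E).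
Proof.
have mV := measurable_value lamP kn.
have V0 x : 0 <= (EFin \o V k) x by rewrite lee_fin value_ge0.
have mEV : measurable_fun [set: X] (EFin \o V k) by exact/measurable_EFinP.
have [_ e] := integral_p_X mEV V0.
rewrite [LHS]e pdf_expectationE.
rewrite [X in _ = - X](eq_integral (fun x => - ((V k x)%:E * (p_X P fU k x)%:E))).
  rewrite integral_ge0N ?oppeK// => x _.
  by rewrite mule_ge0 ?lee_fin ?p_X_ge0//; exact: V0.
by move=> x _; rewrite /value EFinN mulNe oppeK.
Qed.

End policies.

Lemma expected_value_horizon fU : expected_value n fU = 0.
Proof. by apply: integral0_eq => p _; rewrite value_horizon mul0e. Qed.

Lemma eq_f_joint k (fU fU' : nat -> U -> X -> R) (p : X * k.-tuple (U * X)) :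
  (forall i, (i < k)%N -> fU i.+1 = fU' i.+1) -> f_joint P fU p = f_joint P fU' p.
Proof. exact: eq_joint_pdf. Qed.

Lemma measurable_regret k pi : (k < n)%N -> feasible_at P k.+1 pi ->
  measurable_fun [set: X] (fun y => KL muU (pi ^~ y) (fs k.+1 ^~ y)) /\
  forall y, 0 <= KL muU (pi ^~ y) (fs k.+1 ^~ y).
Proof.
move=> kn /feasible_at_cond_pdf ppi.
have V0 x : (0 <= V k.+1 x)%R by exact: value_ge0.
have pfs := feasible_at_cond_pdf (f_star_feasible lamP (kn : (0 < k.+1 <= n)%N) V0).
split; first exact: measurable_KL_cond.
by move=> y; case: ppi pfs => _ ppi [_ pfs]; exact: KL_ge0.
Qed.

(** [stage_identity] averaged over trajectories. The mean of V_(k+1), taken over longer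
    trajectories, is first conditioned on the trajectory up to time k, where it becomes [E]. *)
Lemma stage_cost_value k fU : (k < n)%N ->
  (forall j, (0 < j <= k.+1)%N -> feasible_at P j (fU j)) ->
  stage_cost P k.+1 fU (fU k.+1) + expected_value k.+1 fU =
  regret k fU (fU k.+1) + expected_value k fU.
Proof.
move=> kn fUP.
have fUP' j : (0 < j <= k)%N -> feasible_at P j (fU j).
  by move=> /andP[j0 jk]; apply: fUP; rewrite j0 leqW.
have fk1 := fUP k.+1 (leqnn _).
have V0 x : (0 <= V k.+1 x)%R by exact: value_ge0.
have Vk0 x : (0 <= V k x)%R by exact: value_ge0 (ltnW kn).
have mV := measurable_value lamP kn.
have pfX : is_cond_pdf muX (f_X P k.+1) by exact: f_X_pdf.
have pgX : is_cond_pdf muX (g_X P k.+1) by exact: g_X_pdf.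
have pgU : is_cond_pdf muU (g_U P k.+1) by exact: g_U_pdf.
have pfU := feasible_at_cond_pdf fk1.
have sf := is_cond_pdf_step pfX pfU.
have sg := is_cond_pdf_step pgX pgU.
have [mj j0 _] := f_joint_pdf (ltnW kn) fUP'.
have mEj : measurable_fun setT (EFin \o f_joint P fU (k := k)) by exact/measurable_EFinP.
have ms := @measurable_state _ _ X U k k.
have [mr r0] := measurable_regret kn fk1.
pose D y := KL (sf_product muU muX) (step_pdf (f_X P) fU k.+1 ^~ y)
  (step_pdf (g_X P) (g_U P) k.+1 ^~ y).
pose e (z : X * (U * X)) := (V k.+1 z.2.2)%:E * (step_pdf (f_X P) fU k.+1 z.2 z.1)%:E.
have e0 z : 0 <= e z.
  by rewrite mule_ge0// lee_fin//; case: sf => _ /(_ z.1)[].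
pose E y := \int[sf_product muU muX]_w e (y, w).
have mD : measurable_fun [set: X] D by exact: measurable_KL_cond.
have mE : measurable_fun [set: X] E.
  apply: (@measurable_integral_snd _ _ _ _ _ (sf_product muU muX) e) => //.
  apply: emeasurable_funM; apply/measurable_EFinP.
    apply: (measurableT_comp mV).
    exact: measurableT_comp measurable_snd measurable_snd.
  exact: (measurable_cond_pdf sf).
have D0 y : 0 <= D y.
  by apply: KL_ge0; [case: sf|case: sg].
have E0 y : 0 <= E y by exact: integral_ge0.
have addint (phi psi : X -> \bar R) :
    measurable_fun [set: X] phi -> measurable_fun [set: X] psi ->
    (forall y, 0 <= phi y) -> (forall y, 0 <= psi y) ->
    \int[muT k]_p (phi (state p k) * (f_joint P fU p)%:E) +
    \int[muT k]_p (psi (state p k) * (f_joint P fU p)%:E) =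
    \int[muT k]_p ((phi (state p k) + psi (state p k)) * (f_joint P fU p)%:E).
  move=> mphi mpsi phi0 psi0; rewrite -ge0_integralD//.
  - by apply: eq_integral => p _; rewrite ge0_muleDl.
  - by move=> p _; rewrite mule_ge0// lee_fin.
  - by apply: emeasurable_funM => //; exact: measurableT_comp mphi ms.
  - by move=> p _; rewrite mule_ge0// lee_fin.
  - by apply: emeasurable_funM => //; exact: measurableT_comp mpsi ms.
have -> : stage_cost P k.+1 fU (fU k.+1) =
    \int[muT k]_p (D (state p k) * (f_joint P fU p)%:E).
  exact: pdf_expectationE.
have -> : expected_value k.+1 fU =
    \int[muT k]_p (E (state p k) * (f_joint P fU p)%:E).
  rewrite /expected_value.
  rewrite (integral_jointS (f_joint_plant_pdf kn) (f_joint_policy_pdf fUP) (f_0_pdf P)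
    (h := fun p => (V k.+1 (state p k.+1))%:E) (ltnSn k)); last 2 first.
  - by apply/measurable_EFinP; apply: (measurableT_comp mV); exact: measurable_state.
  - by move=> p; rewrite lee_fin.
  apply: eq_integral => p _; rewrite (eq_integral (fun w => e (state p k, w))) => [//|w _].
  by rewrite state_snoc_last.
rewrite /regret /expected_value.
have mVk : measurable_fun [set: X] (EFin \o V k).
  by apply/measurable_EFinP; exact: measurable_value (ltnW kn).
have Vk0E x : 0 <= (EFin \o V k) x by rewrite lee_fin.
rewrite addint//.
apply: etrans; last exact/esym/(addint _ _ mr mVk r0 Vk0E).
apply: eq_integral => p _; congr (_ * _).
exact: (stage_identity (state p k) (kn : (0 < k.+1 <= n)%N) fk1).
Qed.

(** The form matching [B_rec], in which a candidate overwrites entry [k.+1] of the policies: the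
    joint pdf up to time k does not see that entry. *)
Lemma stage_cost_step k fU pi : (k < n)%N ->
  (forall j, (0 < j <= k)%N -> feasible_at P j (fU j)) -> feasible_at P k.+1 pi ->
  stage_cost P k.+1 fU pi + expected_value k.+1 [eta fU with k.+1 |-> pi] =
  regret k fU pi + expected_value k fU.
Proof.
move=> kn fUP fpi; set fU' := [eta fU with k.+1 |-> pi].
have fU'k : fU' k.+1 = pi by rewrite /fU' /= eqxx.
have ej (p : X * k.-tuple (U * X)) : f_joint P fU p = f_joint P fU' p.
  by apply: eq_f_joint => i ik; rewrite /fU' /= eqSS ltn_eqF.
have fU'P j : (0 < j <= k.+1)%N -> feasible_at P j (fU' j).
  move=> /andP[j0]; rewrite leq_eqVlt => /predU1P[->|jk]; first by rewrite fU'k.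
  by rewrite /fU' /= ltn_eqF//; apply: fUP; rewrite j0.
have := stage_cost_value kn fU'P; rewrite fU'k.
have ejf : f_joint P fU (k := k) = f_joint P fU' (k := k) by exact/funext.
by rewrite /stage_cost /regret /expected_value /= -ejf.
Qed.

Lemma regret_ge0 k fU pi : (k < n)%N ->
  (forall j, (0 < j <= k)%N -> feasible_at P j (fU j)) -> feasible_at P k.+1 pi ->
  0 <= regret k fU pi.
Proof.
move=> kn fUP fpi; apply: integral_ge0 => p _.
have [_ f0 _] := f_joint_pdf (ltnW kn) fUP.
have [_ r0] := measurable_regret kn fpi.
by rewrite mule_ge0// lee_fin.
Qed.

Lemma regret_f_star k fU : (k < n)%N -> regret k fU (fs k.+1) = 0.
Proof.
move=> kn; apply: integral0_eq => p _; rewrite KLxx ?mul0e//.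
have V0 x : (0 <= V k.+1 x)%R by exact: value_ge0.
by have [_] := feasible_at_cond_pdf (f_star_feasible lamP (kn : (0 < k.+1 <= n)%N) V0).
Qed.

(** Through the state marginal the regret is an integral over x_k alone. A vanishing integral of a
    nonnegative function then forces a zero divergence at almost every state of positive density,
    and [KL_eq0] concludes. *)
Lemma regret_eq0 k fU pi : (k < n)%N ->
  (forall j, (0 < j <= k)%N -> feasible_at P j (fU j)) -> feasible_at P k.+1 pi ->
  regret k fU pi = 0 ->
  {ae muX, forall y, (0 < p_X P fU k y)%R ->
    {ae muU, forall u, pi u y = fs k.+1 u y}}.
Proof.
move=> kn fUP fpi; have [mr r0] := measurable_regret kn fpi.
have [mp e] := integral_p_X (ltnW kn) fUP mr r0.
rewrite /regret [X in X = 0 -> _]e => i0.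
have V0 x : (0 <= V k.+1 x)%R by exact: value_ge0.
have [_ pfs] := feasible_at_cond_pdf (f_star_feasible lamP (kn : (0 < k.+1 <= n)%N) V0).
have [_ ppi] := feasible_at_cond_pdf fpi.
have mpr : measurable_fun [set: X]
    (fun y => KL muU (pi ^~ y) (fs k.+1 ^~ y) * (p_X P fU k y)%:E).
  by apply: emeasurable_funM => //; exact/measurable_EFinP.
have [+ _] := ae_eq_integral_abs muX measurableT mpr.
under eq_integral do rewrite gee0_abs ?mule_ge0 ?lee_fin ?p_X_ge0 ?(ltnW kn)//.
move=> /(_ i0); apply: filterS => y /(_ I) /= h p0.
apply: KL_eq0 => //; move/eqP: h; rewrite mule_eq0 => /orP[/eqP//|].
by rewrite eqe gt_eqF.
Qed.

(** The telescoping, by induction on the last time. The mean of V_k stays on the left as a summand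
    since it may be infinite; it vanishes at k = n. *)
Lemma cost_value fU k : (k <= n)%N ->
  (forall j, (0 < j <= k)%N -> feasible_at P j (fU j)) ->
  KL (muT k) (f_joint P fU (k := k)) (g_joint P (k := k)) + expected_value k fU =
  KL (muT 0) (f_joint P fU (k := 0)) (g_joint P (k := 0)) + expected_value 0 fU +
  \sum_(0 <= i < k) regret i fU (fU i.+1).
Proof.
elim: k => [_ _|k ih kn fUP]; first by rewrite big_geq// adde0.
have fUP' j : (0 < j <= k)%N -> feasible_at P j (fU j).
  by move=> /andP[j0 jk]; apply: fUP; rewrite j0 leqW.
rewrite big_nat_recr// [RHS]addeA -ih ?(ltnW kn)//.
(* Feasibility is known only up to time [k.+1], which therefore serves as the horizon. *)
rewrite [X in X + _ = _](KL_jointS (n := k.+1) (f_joint_plant_pdf kn)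
  (f_joint_policy_pdf fUP) (f_0_pdf P) _ _ (g_0_pdf P) (ltnSn k)); last 2 first.
- by move=> j jk; apply: g_X_pdf; exact: le_horizon jk.
- by move=> j jk; apply: g_U_pdf; exact: le_horizon jk.
have := stage_cost_value kn fUP; rewrite /stage_cost pdf_expectationE => e.
by rewrite -addeA [X in _ + X = _]e (addeC (regret _ _ _)) addeA.
Qed.

Lemma f_star_policy_feasible : feasible P fs.
Proof.
move=> k kn; apply: (f_star_feasible lamP kn) => x.
by apply: value_ge0 => //; case/andP: kn.
Qed.

(** The first two terms concern time 0, before any input, so they are common to all policies and can
    be written with [f_star]. *)
Lemma costE fU : feasible P fU ->
  cost P fU = KL (muT 0) (f_joint P fs (k := 0)) (g_joint P (k := 0)) +
    expected_value 0 fs + \sum_(0 <= i < n) regret i fU (fU i.+1).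
Proof.
move=> fUP; have := cost_value (leqnn n) fUP.
rewrite expected_value_horizon adde0 => costE; rewrite /cost costE; congr (_ + _).
have e : f_joint P fU (k := 0) = f_joint P fs (k := 0).
  by apply/funext => p; apply: eq_f_joint.
by rewrite /expected_value e.
Qed.

Lemma feasible_lt fU k : (k < n)%N -> feasible P fU ->
  forall j, (0 < j <= k)%N -> feasible_at P j (fU j).
Proof.
by move=> kn fUP j /andP[j0 jk]; apply: fUP; rewrite j0 (leq_trans jk (ltnW kn)).
Qed.

Lemma regret_feasible_ge0 fU k : (k < n)%N -> feasible P fU ->
  0 <= regret k fU (fU k.+1).
Proof.
by move=> kn fUP; apply: regret_ge0 => //; [exact: feasible_lt|exact: fUP].
Qed.

Lemma cost_f_star :
  cost P fs = KL (muT 0) (f_joint P fs (k := 0)) (g_joint P (k := 0)) +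
    expected_value 0 fs.
Proof.
rewrite (costE f_star_policy_feasible) big_nat_cond big1 ?adde0// => i /andP[/andP[_ ni] _].
exact: regret_f_star.
Qed.

Lemma f_star_solution : is_solution P fs.
Proof.
split=> [|fU fUP]; first exact: f_star_policy_feasible.
rewrite cost_f_star costE// leeDl// big_nat_cond; apply: sume_ge0 => i /andP[/andP[_ ni] _].
exact: regret_feasible_ge0.
Qed.

Lemma solution_unique fU : is_solution P fU -> cost P fU < +oo ->
  forall k, (0 < k <= n)%N ->
  {ae muX, forall y, (0 < p_X P fU k.-1 y)%R ->
    {ae muU, forall u, fU k u y = fs k u y}}.
Proof.
move=> [fUP fUmin] fUfin [//|k] kn.
apply: regret_eq0 => //; [exact: feasible_lt|exact: fUP|].
have nofeas fU' j : (0 < j <= 0)%N -> feasible_at P j (fU' j) by case: j.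
have pf := f_joint_pdf (leq0n n) (nofeas fs).
have pg : is_pdf (muT 0) (g_joint P (k := 0)).
  have gX0 j : (0 < j <= 0)%N -> is_cond_pdf muX (g_X P j) by case: j.
  have gU0 j : (0 < j <= 0)%N -> is_cond_pdf muU (g_U P j) by case: j.
  exact: (is_pdf_joint gX0 gU0 (g_0_pdf P) (leqnn 0)).
(* This constant is the cost of [f_star], at most that of [fU], hence finite; it can then be
   cancelled. *)
have C0 : KL (muT 0) (f_joint P fs (k := 0)) (g_joint P (k := 0)) +
    expected_value 0 fs \is a fin_num.
  rewrite ge0_fin_numE -?cost_f_star.
    by apply: le_lt_trans fUfin; case: f_star_solution => _; exact.
  rewrite cost_f_star; apply: adde_ge0; first exact: KL_ge0.
  have [_ f0 _] := pf.
  by apply: integral_ge0 => p _; rewrite mule_ge0// lee_fin ?value_ge0.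
have := fUmin _ f_star_policy_feasible.
rewrite costE// cost_f_star -[leRHS]adde0 leeD2lE// => sum0.
have r0 i : (i < n)%N -> 0 <= regret i fU (fU i.+1) by move=> ?; exact: regret_feasible_ge0.
apply/eqP; rewrite eq_le r0// andbT; apply: le_trans sum0.
(* The regrets are nonnegative with sum at most 0, and each one is bounded by the sum. *)
rewrite big_mkord (bigD1 (Ordinal kn))//= leeDl//.
by apply: sume_ge0 => i _; exact: r0.
Qed.

(** Induction on the number m of stages left, for all earlier policies at once, because the later
    sub-problem is posed after each candidate. By [step] the objective is the regret plus a term
    free of the candidate, so the infimum is reached at regret 0, that is at [f_star]. *)
Lemma B_recE m k fU : (k + m)%N = n ->
  (forall j, (0 < j <= k)%N -> feasible_at P j (fU j)) ->
  B_rec P m k.+1 fU = expected_value k fU.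
Proof.
elim: m k fU => [k fU|m ih k fU kmn fUP].
  by rewrite addn0 => -> _; rewrite expected_value_horizon.
have kn : (k < n)%N by rewrite -kmn addnS ltnS leq_addr.
have step pi : feasible_at P k.+1 pi ->
    stage_cost P k.+1 fU pi + B_rec P m k.+2 [eta fU with k.+1 |-> pi] =
    regret k fU pi + expected_value k fU.
  move=> fpi; rewrite -stage_cost_step// ih//; first by rewrite addSnnS.
  move=> j /andP[j0]; rewrite leq_eqVlt => /predU1P[->|jk]; first by rewrite /= eqxx.
  by rewrite /= ltn_eqF//; apply: fUP; rewrite j0.
apply/eqP; rewrite eq_le; apply/andP; split.
  apply: ereal_inf_lbound; exists (fs k.+1); first exact: f_star_policy_feasible.
  rewrite step ?regret_f_star ?add0e//; exact: f_star_policy_feasible.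
apply: le_ereal_inf_tmp => _ [pi fpi <-]; rewrite step// leeDr//.
exact: regret_ge0.
Qed.

Lemma B_starE k fU : (0 < k <= n)%N ->
  (forall j, (0 < j < k)%N -> feasible_at P j (fU j)) ->
  B_star P k fU = expected_value k.-1 fU /\
  B_star P k fU = stage_cost P k fU (fs k) + B_star P k.+1 [eta fU with k |-> fs k].
Proof.
case: k => // k kn fUP; have kn' : (k <= n)%N by exact: ltnW.
have fUP' j : (0 < j <= k)%N -> feasible_at P j (fU j) by exact: fUP.
rewrite /B_star subSS B_recE ?subnKC//; split => //.
rewrite subSS B_recE ?subnKC//.
  by rewrite stage_cost_step// ?regret_f_star ?add0e//; exact: f_star_policy_feasible.
move=> j /andP[j0]; rewrite leq_eqVlt => /predU1P[->|jk].
  by rewrite /= eqxx; exact: f_star_policy_feasible.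
by rewrite /= ltn_eqF//; apply: fUP; rewrite j0.
Qed.

End multistage.

(** Uniqueness is up to null sets and at states of positive density, since a pdf matters only there;
    if the optimal cost is [+oo], every feasible policy is a solution, whence the finiteness
    condition. The second equality for [B_star] records that the infimum defining it is attained at
    [f_star], so that it is a minimum. *)
Theorem theorem1 (R : realType) (dx du : nat)
    (P : control_problem (lebesgue R dx) (lebesgue R du))
    (lam0 : nat -> Rvec R dx -> R)
    (lam : forall k, Rvec R dx -> 'cV[R]_(nc P k)) :
  (forall k, (0 < k <= horizon P)%N ->
     alg_independent (lebesgue R du) (U_dom P k) (h_tilde P k)) ->
  are_multipliers lam0 lam ->
  [/\ is_solution P (f_star lam0 lam),
      forall fU, is_solution P fU -> (cost P fU < +oo)%E ->
        forall k, (0 < k <= horizon P)%N ->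
        {ae lebesgue R dx, forall y, 0 < p_X P fU k.-1 y ->
          {ae lebesgue R du, forall u, fU k u y = f_star lam0 lam k u y}},
      forall w, beta_hat lam0 lam (horizon P) w = 0%E,
      forall k, (0 < k <= horizon P)%N -> forall y,
        ((lam0 k y)%:E =
         lne (\int[lebesgue R du]_(u in U_dom P k)
                ((g_U P k u y)%:E * tilt lam0 lam k u y)) - 1)%E
    & forall k fU, (0 < k <= horizon P)%N ->
        (forall j, (0 < j < k)%N -> feasible_at P j (fU j)) ->
        B_star P k fU =
          (- pdf_expectation (lebesgue R dx) (p_X P fU k.-1)
               (fun y => (ln (gamma_hat lam0 lam k.-1 y))%:E))%E /\
        B_star P k fU =
          (stage_cost P k fU (f_star lam0 lam k)
             + B_star P k.+1 [eta fU with k |-> f_star lam0 lam k])%E].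
Proof.
move=> _ lamP; split.
- exact: f_star_solution.
- by move=> fU; exact: solution_unique.
- move=> w; rewrite /beta_hat pdf_expectationE.
  rewrite integral0_eq ?oppe0// => x _.
  by rewrite /gamma_hat ltnn ln1 mul0e.
- by move=> k kn y; exact: lam0E.
move=> k fU kn fUP; have [B_value B_step] := B_starE lamP kn fUP.
split; last exact: B_step.
rewrite B_value; case: k kn fUP {B_value B_step} => // k kn fUP.
exact: (expected_valueE lamP (ltnW kn) fUP).
Qed.
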